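(* Let $F$ be a number field and $n,n'\ge1$ integers. Let $\pi\in\mathfrak F_n$ and $\pi'\in\mathfrak F_{n'}$ have arithmetic conductors $\mathfrak q_\pi$ and $\mathfrak q_{\pi'}$. If $\mathfrak n$ is a nonzero integral ideal of $\mathcal O_F$ with $(\mathfrak n,\mathfrak q_\pi\mathfrak q_{\pi'})=\mathcal O_F$, then $$\big|\mathrm{Re}\big(\lambda_{\pi\times\pi'}(\mathfrak n)-\lambda_\pi(\mathfrak n)\lambda_{\pi'}(\mathfrak n)\big)\big|^2\le\big(\lambda_{\pi\times\widetilde\pi}(\mathfrak n)-|\lambda_\pi(\mathfrak n)|^2\big)\big(\lambda_{\pi'\times\widetilde\pi'}(\mathfrak n)-|\lambda_{\pi'}(\mathfrak n)|^2\big).$$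
   Context: $F$ has ring of integers $\mathcal O_F$, absolute norm $\mathrm N$, adele ring $\mathbb A_F$; $(\mathfrak a,\mathfrak b)$ is the GCD of integral ideals. $\mathfrak F_n$ is the set of cuspidal automorphic representations of $\mathrm{GL}_n(\mathbb A_F)$ with unitary central character, normalized so that the central character is trivial on the diagonally embedded copy of the positive reals. $\widetilde\pi\in\mathfrak F_n$ is the contragredient of $\pi$; one has $\mathfrak q_{\widetilde\pi}=\mathfrak q_\pi$ and its Satake parameters satisfy $\{\alpha_{j,\widetilde\pi}(\mathfrak p)\}=\{\overline{\alpha_{j,\pi}(\mathfrak p)}\}$. The numbers $\lambda_\pi(\mathfrak n)$ are the Dirichlet coefficients of the standard $L$-function $L(s,\pi)=\prod_{\mathfrak p}\prod_{j=1}^n(1-\alpha_{j,\pi}(\mathfrak p)\mathrm N\mathfrak p^{-s})^{-1}=\sum_{\mathfrak n}\lambda_\pi(\mathfrak n)\mathrm N\mathfrak n^{-s}$, where $\alpha_{j,\pi}(\mathfrak p)$ are the Satake parameters. The numbers $\lambda_{\pi\times\pi'}(\mathfrak n)$ are the (multiplicative) Dirichlet coefficients of the Rankin–Selberg $L$-function $L(s,\pi\times\pi')=\prod_{\mathfrak p}L(s,\pi_{\mathfrak p}\times\pi'_{\mathfrak p})=\sum_{\mathfrak n}\lambda_{\pi\times\pi'}(\mathfrak n)\mathrm N\mathfrak n^{-s}$; for $\mathfrak p\nmid\mathfrak q_\pi\mathfrak q_{\pi'}$ the Euler factor is $L(s,\pi_{\mathfrak p}\times\pi'_{\mathfrak p})=\prod_{j=1}^n\prod_{j'=1}^{n'}(1-\alpha_{j,\pi}(\mathfrak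 p)\alpha_{j',\pi'}(\mathfrak p)\mathrm N\mathfrak p^{-s})^{-1}=\sum_{k\ge0}\lambda_{\pi\times\pi'}(\mathfrak p^k)\mathrm N\mathfrak p^{-ks}$. The same definitions apply to $\pi\times\widetilde\pi$ and $\pi'\times\widetilde\pi'$. *)

(* Defs.v *)
From HB Require Import structures.
From mathcomp Require Import all_boot all_order all_algebra all_field.
From mathcomp Require Import all_classical all_reals all_analysis.
From mathcomp Require Import finmap complex.
Set Implicit Arguments.
Unset Strict Implicit.
Unset Printing Implicit Defensive.
Import Order.TTheory GRing.Theory Num.Theory.
Local Open Scope classical_set_scope.
Local Open Scope ring_scope.

(* Ideals of the ring of integers of a number field F are sets of elements
   of F. *)

Section Ideals.
Context (F : fieldExtType rat).

Definition ring_of_integers : set F :=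
  [set x | integralOver (intr : int -> F) x].

Local Notation OF := ring_of_integers.

Definition integral_ideal (a : set F) : Prop :=
  [/\ a `<=` OF, a 0,
      (forall x y, a x -> a y -> a (x + y)) &
      (forall r x, OF r -> a x -> a (r * x))].

Definition nonzero_ideal (a : set F) : Prop :=
  integral_ideal a /\ exists2 x, a x & x != 0.

Definition nonzero_prime (p : set F) : Prop :=
  [/\ nonzero_ideal p, ~ p 1 &
      (forall x y, OF x -> OF y -> p (x * y) -> p x \/ p y)].

Definition ideal_add (a b : set F) : set F :=
  [set z | exists x y, [/\ a x, b y & z = x + y]].

Definition ideal_mul (a b : set F) : set F :=
  [set z | exists (m : nat) (x y : 'I_m -> F),
     [/\ forall i, a (x i), forall i, b (y i) & z = \sum_i x i * y i]].

Definition ideal_exp (a : set F) (k : nat) : set F := iter k (ideal_mul a) OF.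

Definition ideal_coset (a : set F) (x : F) : set F := [set x + y | y in a].

Definition ideal_norm (a : set F) : nat :=
  (#|` fset_set (ideal_coset a @` OF)|)%fset.

Definition finplace : Type := {p : set F | nonzero_prime p}.

(* The primes dividing n; this is a finite set when n is nonzero. *)
Definition prime_divisors (n : set F) : set (set F) :=
  [set p | nonzero_prime p /\ n `<=` p].

Definition ideal_ord (p n : set F) : nat :=
  xget 0%N [set k | n `<=` ideal_exp p k /\ ~ n `<=` ideal_exp p k.+1].

End Ideals.

Arguments ring_of_integers : clear implicits.

Section Places.
Context (R : realType) (F : fieldExtType rat).

(* An infinite place is a class of embeddings of F into the complex numbers
   modulo conjugation; it is determined by the absolute value |sigma(x)|. *)
Definition infplace : Type :=
  {w : F -> R | exists sigma : {rmorphism F -> R[i]},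
                  forall x, w x = Normc.normc (sigma x)}.

Definition place : Type := (finplace F + infplace)%type.

(* At a prime p this forces |x| = Np^(- ord_p x). *)
Definition place_absval (v : place) (w : F -> R) : Prop :=
  match v with
  | inl p => forall x k, ring_of_integers F x ->
      (w x <= ((ideal_norm (sval p))%:R ^+ k)^-1) <-> ideal_exp (sval p) k x
  | inr w0 => forall x, w x = sval w0 x
  end.

(* The completion F_v, given by the properties that characterize it up to a
   unique isometric isomorphism over F. *)
Record completion (v : place) : Type := Completion {
  cfield : fieldType;
  cabs : cfield -> R;
  cemb : {rmorphism F -> cfield};
  cabs_ge0 : forall x, 0 <= cabs x;
  cabs_eq0 : forall x, cabs x = 0 <-> x = 0;
  cabsM : forall x y, cabs (x * y) = cabs x * cabs y;
  cabsD : forall x y, cabs (x + y) <= cabs x + cabs y;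
  cabs_emb : place_absval v (fun x => cabs (cemb x));
  cdense : forall x e, 0 < e -> exists y, cabs (x - cemb y) < e;
  ccomplete : forall u : nat -> cfield,
    (forall e, 0 < e -> exists N, forall i j,
       (N <= i)%N -> (N <= j)%N -> cabs (u i - u j) < e) ->
    exists l, forall e, 0 < e -> exists N, forall i,
       (N <= i)%N -> cabs (u i - l) < e }.

End Places.

Definition completions (R : realType) (F : fieldExtType rat) : Type :=
  forall v : place R F, completion v.

(* GL_n of the adeles, as the restricted product of the GL_n(F_v) with respect
   to the GL_n(O_v).  To avoid subtypes, the ambient type is the full product
   of the matrix algebras, and GL_n(A_F) is the set [GLA] in it. *)

Section GLn.
Context (R : realType) (F : fieldExtType rat) (K : completions R F) (n : nat).

Definition mxfam : Type := forall v : place R F, 'M[cfield (K v)]_n.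

HB.instance Definition _ := gen_eqMixin mxfam.
HB.instance Definition _ := gen_choiceMixin mxfam.
HB.instance Definition _ := isPointed.Build mxfam (fun=> 1%:M).

Definition mulf (g h : mxfam) : mxfam := fun v => g v *m h v.

Definition GLO (p : finplace F) (g : 'M[cfield (K (inl p))]_n) : Prop :=
  (forall i j, cabs (g i j) <= 1) /\ cabs (\det g) = 1.

Definition GLA : set mxfam :=
  [set g : mxfam | (forall v, g v \in unitmx) /\
           finite_set [set p : finplace F | ~ GLO (g (inl p))]].

Definition GLA_open (U : set mxfam) : Prop :=
  U `<=` GLA /\
  forall g, U g -> exists (S : set (place R F)) (e : R),
    [/\ finite_set S, 0 < e &
     forall h, GLA h ->
       (forall v, S v -> forall i j, cabs (h v i j - g v i j) < e) ->
       (forall p : finplace F, ~ S (inl p) ->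
          GLO (invmx (g (inl p)) *m h (inl p))) ->
       U h].

Definition GLF : set mxfam :=
  [set g : mxfam | exists2 gam : 'M[F]_n, gam \in unitmx &
           forall v, g v = map_mx (cemb (K v)) gam].

Definition scalarf (z : forall v : place R F, cfield (K v)) : mxfam :=
  fun v => (z v)%:M.

(* x is the real number t, seen in F_v for an infinite place v *)
Definition is_real (w : infplace R F) (t : R) (x : cfield (K (inr w))) : Prop :=
  forall e, 0 < e -> exists q : rat,
    `|ratr q - t| < e /\ cabs (ratr q - x) < e.

(* The idele t at all infinite places and 1 at all finite ones, t > 0 *)
Definition pos_idele (z : forall v : place R F, cfield (K v)) : Prop :=
  exists2 t : R, 0 < t &
    (forall p : finplace F, z (inl p) = 1) /\
    (forall w : infplace R F, is_real t (z (inr w))).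

Definition Gam : set mxfam :=
  [set g : mxfam | exists gam z, [/\ GLF gam, pos_idele z & g = mulf (scalarf z) gam]].

(* For a subgroup D of a closed subgroup H of GL_n(A_F), the traces on H of
   the left D-invariant open sets.  They are the inverse images of the open
   sets of D\H, so that the sigma-algebra they generate is that of the Borel
   sets of D\H, and a function measurable for it is left D-invariant. *)
Definition quot_open (D H : set mxfam) : set (set mxfam) :=
  [set A | exists2 U, GLA_open U /\
             (forall d g, D d -> U g -> U (mulf d g)) & A = U `&` H].

Definition quot_type (D H : set mxfam) : Type :=
  g_sigma_algebraType (quot_open D H).
HB.instance Definition _ D H := Measurable.on (quot_type D H).

Definition invariant_prob (D H : set mxfam)
    (mu : probability (quot_type D H) R) : Prop :=
  mu H = 1%E /\
  forall (A : set (quot_type D H)) (h : mxfam), measurable A -> A `<=` H ->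
    H h -> mu [set mulf g h | g in A] = mu A.

(* X denotes GL_n(F) R_{>0} \ GL_n(A_F). *)

Context (mu : probability (quot_type Gam GLA) R).

Local Notation C := R[i].

Definition aeq (phi psi : mxfam -> C) : Prop :=
  {ae mu, forall g, GLA g -> phi g = psi g}.

Definition ae_zero (phi : mxfam -> C) : Prop := aeq phi (fun=> 0).

Definition cmeasurable (D H : set mxfam) (phi : mxfam -> C) : Prop :=
  measurable_fun (H : set (quot_type D H)) (fun g => complex.Re (phi g)) /\
  measurable_fun (H : set (quot_type D H)) (fun g => complex.Im (phi g)).

Definition sqint (phi : mxfam -> C) : \bar R :=
  (\int[mu]_(g in GLA) ((Normc.normc (phi g)) ^+ 2)%:E)%E.

Definition L2 (phi : mxfam -> C) : Prop :=
  [/\ forall d g, Gam d -> GLA g -> phi (mulf d g) = phi g,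
      cmeasurable Gam GLA phi & (sqint phi < +oo)%E].

Definition L2norm (phi : mxfam -> C) : R := Num.sqrt (fine (sqint phi)).

Definition rtrans (h : mxfam) (phi : mxfam -> C) : mxfam -> C :=
  fun g => phi (mulf g h).

Definition lincomb (a : C) (phi psi : mxfam -> C) : mxfam -> C :=
  fun g => a * phi g + psi g.

Definition closed_subrep (V : set (mxfam -> C)) : Prop :=
  [/\ V `<=` L2, V (fun=> 0),
      forall a phi psi, V phi -> V psi -> V (lincomb a phi psi),
      forall h phi, GLA h -> V phi -> V (rtrans h phi) &
      forall phi, L2 phi ->
        (forall e, 0 < e -> exists2 psi, V psi & L2norm (phi \- psi) < e) ->
        V phi].

Definition irreducible (V : set (mxfam -> C)) : Prop :=
  [/\ closed_subrep V, exists2 phi, V phi & ~ ae_zero phi &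
      forall W, closed_subrep W -> W `<=` V -> W `<=` ae_zero \/ V `<=` W].

(* The unipotent radical of the standard parabolic of type (k, n - k) *)
Definition unipA (k : nat) : set mxfam :=
  [set g : mxfam | GLA g /\ forall v (i j : 'I_n),
             ~~ ((i < k) && (k <= j))%N -> g v i j = (i == j)%:R].

Definition unipF (k : nat) : set mxfam := unipA k `&` GLF.

(* The exceptional set lies in a null set of X if and only if it is null in
   GL_n(A_F), as GL_n(F) is countable. *)
Definition cuspidal (phi : mxfam -> C) : Prop :=
  forall k, (0 < k < n)%N ->
  forall nu : probability (quot_type (unipF k) (unipA k)) R,
    invariant_prob nu ->
  {ae mu, forall g, GLA g ->
     \int[nu]_(u in unipA k) complex.Re (phi (mulf u g)) = 0 /\
     \int[nu]_(u in unipA k) complex.Im (phi (mulf u g)) = 0}.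

Definition has_unitary_central_char (V : set (mxfam -> C)) : Prop :=
  exists om : (forall v : place R F, cfield (K v)) -> C,
  forall z, GLA (scalarf z) ->
    [/\ `|om z| = 1, pos_idele z -> om z = 1 &
        forall phi, V phi ->
          aeq (rtrans (scalarf z) phi) (fun g => om z * phi g)].

Definition cuspidal_automorphic (V : set (mxfam -> C)) : Prop :=
  [/\ irreducible V, forall phi, V phi -> cuspidal phi &
      has_unitary_central_char V].

Definition fixed_by (H : set mxfam) (phi : mxfam -> C) : Prop :=
  forall h, H h -> aeq (rtrans h phi) phi.

(* K_1(a): integral matrices at the finite places with last row congruent to
   (0, ..., 0, 1) modulo a *)
Definition K1 (a : set F) : set mxfam :=
  [set g : mxfam | [/\ GLA g, forall w : infplace R F, g (inr w) = 1%:M &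
    forall p : finplace F, GLO (g (inl p)) /\
      forall i j : 'I_n, i.+1 = n -> exists2 x, a x &
        cabs (g (inl p) i j - (i == j)%:R) <= cabs (cemb (K (inl p)) x)]].

(* The ideal q is the arithmetic conductor of V (theory of the newform) *)
Definition is_conductor (V : set (mxfam -> C)) (q : set F) : Prop :=
  nonzero_ideal q /\
  forall a, nonzero_ideal a ->
    (exists phi, [/\ V phi, ~ ae_zero phi & fixed_by (K1 a) phi]) <->
    a `<=` q.

(* The image of GL_n(F_p) in GL_n(A_F) *)
Definition GLp (p : finplace F) : set mxfam :=
  [set g : mxfam | GLA g /\ forall v, v <> inl p -> g v = 1%:M].

Definition Kp (p : finplace F) : set mxfam :=
  [set g : mxfam | GLp p g /\ GLO (g (inl p))].

Definition is_hecke_elt (p : finplace F) (x : cfield (K (inl p))) (r : nat)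
    (t : mxfam) : Prop :=
  GLp p t /\
  t (inl p) = diag_mx (\row_(i < n) (if (i < r)%N then x else 1)).

(* s is a system of representatives of the cosets hK in the double coset
   KtK *)
Definition coset_reps (H : set mxfam) (t : mxfam) (m : nat)
    (s : 'I_m -> mxfam) : Prop :=
  (forall h, (exists k1 k2, [/\ H k1, H k2 & h = mulf (mulf k1 t) k2]) <->
             (exists i k, H k /\ h = mulf (s i) k)) /\
  (forall i j k, H k -> s j = mulf (s i) k -> i = j).

Definition elsym (r : nat) (a : 'I_n -> C) : C :=
  \sum_(A : {set 'I_n} | #|A| == r) \prod_(i in A) a i.

(* At a prime p where V is unramified, the characteristic function of
   K_p diag(x, ..., x, 1, ..., 1) K_p (with r times a uniformizer x) acts on
   the K_p-fixed vectors by Np^(r(n-r)/2) e_r(a_1, ..., a_n), where the a_j are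
   the Satake parameters at p. *)
Definition is_satake (V : set (mxfam -> C)) (p : finplace F)
    (a : 'I_n -> C) : Prop :=
  exists2 x : cfield (K (inl p)), cabs x = (ideal_norm (sval p))%:R^-1 &
  forall r, (r <= n)%N ->
  exists (t : mxfam) (m : nat) (s : 'I_m -> mxfam),
    [/\ is_hecke_elt x r t, coset_reps (Kp p) t s &
     forall phi, V phi -> fixed_by (Kp p) phi ->
       aeq (fun g => \sum_i phi (mulf g (s i)))
         (fun g =>
           (Num.sqrt (ideal_norm (sval p))%:R ^+ (r * (n - r)))%:C%C *
           elsym r a * phi g)].

(* An element of F_n: an irreducible cuspidal subspace of L^2(X), with its
   conductor and its Satake parameters at the unramified primes.  The latter
   two are determined by the space (up to order for the Satake parameters). *)
Record cusp_rep : Type := CuspRep {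
  cspace : set (mxfam -> C);
  conductor : set F;
  satake : finplace F -> 'I_n -> C;
  cspaceP : cuspidal_automorphic cspace;
  conductorP : is_conductor cspace conductor;
  satakeP : forall p, ~ conductor `<=` sval p ->
    is_satake cspace p (satake p) }.

(* W is the contragredient of V: there is a bounded invariant bilinear form on
   V x W identifying W with the dual of the Hilbert space V. *)
Definition contragredient (V W : cusp_rep) : Prop :=
  exists B : (mxfam -> C) -> (mxfam -> C) -> C,
  [/\ (forall a phi1 phi2 psi,
         cspace V phi1 -> cspace V phi2 -> cspace W psi ->
         B (lincomb a phi1 phi2) psi = a * B phi1 psi + B phi2 psi) /\
      (forall a phi psi1 psi2,
         cspace V phi -> cspace W psi1 -> cspace W psi2 ->
         B phi (lincomb a psi1 psi2) = a * B phi psi1 + B phi psi2),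
      exists M : R, forall phi psi, cspace V phi -> cspace W psi ->
        Normc.normc (B phi psi) <= M * L2norm phi * L2norm psi,
      forall h phi psi, GLA h -> cspace V phi -> cspace W psi ->
        B (rtrans h phi) (rtrans h psi) = B phi psi,
      forall psi, cspace W psi -> (forall phi, cspace V phi -> B phi psi = 0) ->
        ae_zero psi &
      forall l : (mxfam -> C) -> C,
        (forall a phi1 phi2, cspace V phi1 -> cspace V phi2 ->
           l (lincomb a phi1 phi2) = a * l phi1 + l phi2) ->
        (exists M : R, forall phi, cspace V phi ->
           Normc.normc (l phi) <= M * L2norm phi) ->
        exists2 psi, cspace W psi & forall phi, cspace V phi ->
          l phi = B phi psi].

End GLn.

Arguments GLA {R F} K n.
Arguments Gam {R F} K n.

Record autom_measure (R : realType) (F : fieldExtType rat)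
    (K : completions R F) (n : nat) : Type := AutomMeasure {
  am_measure : probability (quot_type (Gam K n) (GLA K n)) R;
  am_measureP : invariant_prob am_measure }.

Section DirichletCoefficients.
Context (R : realType) (F : fieldExtType rat) (K : completions R F).
Local Notation C := R[i].

(* lam (p^k), k >= 0, are the coefficients of the power series 1 / E. *)
Definition local_coeffs (E : {poly C}) (p : set F) (lam : set F -> C) : Prop :=
  forall k, \sum_(i < k.+1) E`_i * lam (ideal_exp p (k - i)) = (k == 0%N)%:R.

(* lam (n) is the coefficient of Nn^(-s) in the formal expansion of the Euler
   product of the sums of lam (p^k) Np^(-ks). *)
Definition euler_expansion (lam : set F -> C) : Prop :=
  forall n, nonzero_ideal n ->
    lam n = \prod_(p <- fset_set (prime_divisors n))
              lam (ideal_exp p (ideal_ord p n)).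

(* In the next two definitions the Euler factors at the ramified primes are
   left arbitrary. *)
Definition standard_coeffs (n : nat) (mu : probability
    (quot_type (Gam K n) (GLA K n)) R) (pi : cusp_rep mu)
    (lam : set F -> C) : Prop :=
  euler_expansion lam /\
  forall p : finplace F, ~ conductor pi `<=` sval p ->
    local_coeffs (\prod_j (1 - (satake pi p j)%:P * 'X)) (sval p) lam.

Definition rankin_selberg_coeffs (n n' : nat)
    (mu : probability (quot_type (Gam K n) (GLA K n)) R)
    (mu' : probability (quot_type (Gam K n') (GLA K n')) R)
    (pi : cusp_rep mu) (pi' : cusp_rep mu') (lam : set F -> C) : Prop :=
  euler_expansion lam /\
  forall p : finplace F,
    ~ ideal_mul (conductor pi) (conductor pi') `<=` sval p ->
    local_coeffs
      (\prod_j \prod_j' (1 - (satake pi p j * satake pi' p j')%:P * 'X))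
      (sval p) lam.

End DirichletCoefficients.

(* Main.v *)
(* Away from the conductors, Newton's identities express the coefficients at p^k
   as expectations over a random cycle type (i_1, i_2, ...):
   lam_pi (p^k) = E[X] and lam_pi' (p^k) = E[Y], where X and Y are the products
   of the power sums p_(i_1) p_(i_2) ... in the Satake parameters of pi and pi'.
   Power sums are multiplicative under the tensor product, so
   lam_pixpi' (p^k) = E[XY]; since the Satake parameters of the contragredient
   are conjugate to those of pi, lam_pixtpi (p^k) = E[|X|^2].  Passing to the
   product probability space over the primes dividing n, the inequality becomes
   |Cov(X, conj Y)|^2 <= Var X Var Y.

   For the Satake parameters of the contragredient: if phi is a newvector of pi,
   the functional <., phi> is represented, through the invariant pairing, by some
   psi in the contragredient.  Then psi is fixed by the same compact subgroups as
   phi, which compares the conductors, and a Hecke operator with eigenvalue c on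
   phi acts on psi with eigenvalue conj c. *)
Require Import Defs.
From HB Require Import structures.
From mathcomp Require Import all_boot all_order all_algebra all_field.
From mathcomp Require Import all_classical all_reals all_analysis.
From mathcomp Require Import finmap complex.
From mathcomp Require Import measurable_realfun ring lra.
Set Implicit Arguments.
Unset Strict Implicit.
Unset Printing Implicit Defensive.
Import Order.TTheory GRing.Theory Num.Theory.
Local Open Scope classical_set_scope.
Local Open Scope ring_scope.

Local Notation mulf := Defs.mulf.
Local Notation quot_type := Defs.quot_type.

(** * Newton's identities *)

Lemma dvdXnP (K : fieldType) (N : nat) (p : {poly K}) :
  reflect (forall i, (i < N)%N -> p`_i = 0) ('X^N %| p).
Proof.
apply: (iffP idP) => [/dvdpP[q ->] i iN|p0]; first by rewrite coefMXn iN.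
apply/dvdpP; exists (drop_poly N p); rewrite -[LHS](poly_take_drop N).
rewrite [take_poly N p](_ : _ = 0) ?add0r//.
by apply/polyP => i; rewrite coef_take_poly coef0; case: ifP => // /p0.
Qed.

Section Newton.
Context (K : fieldType) (I : finType).
Implicit Types (a b : I -> K).

Definition psum a (k : nat) : K := \sum_j a j ^+ k.

Definition euler_poly a : {poly K} := \prod_j (1 - (a j)%:P * 'X).

(** A truncation of $-X E'/E$, where $E$ is [euler_poly a]. The constant term is set to 0 because
    [psum a 0] would count the indices. *)
Definition psum_poly N a : {poly K} :=
  \poly_(i < N) (if i == 0%N then 0 else psum a i).

Lemma psum_polyE N a :
  psum_poly N.+1 a = \sum_j \sum_(i < N) ((a j)%:P * 'X) ^+ i.+1.
Proof.
transitivity (\sum_j \sum_(i < N) (a j ^+ i.+1) *: 'X^(i.+1)); last first.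
  apply: eq_bigr => j _; apply: eq_bigr => i _.
  by rewrite exprMn -polyC_exp mul_polyC.
rewrite exchange_big /= /psum_poly poly_def big_ord_recl /= scale0r add0r.
by apply: eq_bigr => i _; rewrite /= /psum scaler_suml.
Qed.

(** Logarithmic differentiation, one factor at a time: a factor $1 - y$ contributes $-y/(1-y)$, and
    multiplying the truncated geometric series by $1 - y$ leaves the error [y ^+ N.+1], a multiple
    of $X^{N+1}$. *)
Lemma euler_poly_deriv N a :
  'X^(N.+1) %| 'X * (euler_poly a)^`() + euler_poly a * psum_poly N.+1 a.
Proof.
rewrite psum_polyE /euler_poly.
elim/big_rec2: _ => [|j E P _ IH]; first by rewrite derivC !mulr0 addr0 dvdp0.
set y := (a j)%:P * 'X.
have Xe : 'X * (1 - y)^`() = - y.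
  by rewrite derivB derivC deriv_mulC derivX /y; ring.
have eP : (1 - y) * \sum_(i < N) y ^+ i.+1 = y - y ^+ N.+1.
  under eq_bigr do rewrite exprS.
  have := subrX1 y N; rewrite -mulr_sumr exprS => yN.
  transitivity (- y * ((y - 1) * \sum_(i < N) y ^+ i)); first by ring.
  by rewrite -yN; ring.
have -> : 'X * ((1 - y) * P)^`() + (1 - y) * P * (\sum_(i < N) y ^+ i.+1 + E) =
   (1 - y) * ('X * P^`() + P * E)
   + P * ('X * (1 - y)^`() + (1 - y) * \sum_(i < N) y ^+ i.+1).
  by rewrite derivM; ring.
rewrite dvdp_add ?dvdp_mull// Xe eP [X in _ %| X](_ : _ = - y ^+ N.+1); last by ring.
by rewrite dvdpNr exprMn dvdp_mull.
Qed.

Lemma coef_euler_poly0 a : (euler_poly a)`_0 = 1.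
Proof.
rewrite /euler_poly coef0_prod big1// => j _.
by rewrite coefB coef1 mulrC coefXM subr0.
Qed.

Lemma dvdXn_euler_mul N a p : 'X^N %| euler_poly a * p -> 'X^N %| p.
Proof.
rewrite Gauss_dvdpr// coprimep_sym coprimep_expr// coprimepX.
by rewrite /root horner_coef0 coef_euler_poly0 oner_eq0.
Qed.

(** With $T$ the truncated series of [L], $E T \equiv 1$ modulo $X^{k+1}$. Applying $X\,d/dX$ and
    replacing $X E'$ by $-E P$, where $P$ is [psum_poly], gives $E (X T' - P T) \equiv 0$. The
    factor $E$ cancels since its constant term is 1, and the coefficient of $X^k$ is the
    identity. *)
Lemma newton a (L : nat -> K) :
  (forall k, \sum_(i < k.+1) (euler_poly a)`_i * L (k - i)%N = (k == 0%N)%:R) ->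
  forall k, k%:R * L k = \sum_(i < k) psum a i.+1 * L (k - i.+1)%N.
Proof.
move=> EL k; pose T := \poly_(i < k.+1) L i.
have ET : 'X^(k.+1) %| euler_poly a * T - 1.
  apply/dvdXnP => i ik; rewrite coefB coef1 coefM.
  rewrite -(EL i) [X in X - _](_ : _ = \sum_(j < i.+1) (euler_poly a)`_j * L (i - j)%N) ?subrr//.
  apply: eq_bigr => j _; rewrite coef_poly (leq_ltn_trans _ ik)//; exact: leq_subr.
(* The factor $X$ makes up for the power lost in differentiating a multiple of $X^{k+1}$. *)
have XET : 'X^(k.+1) %| 'X * (euler_poly a)^`() * T + euler_poly a * ('X * T^`()).
  have /dvdpP[q Eq] := ET.
  have -> : 'X * (euler_poly a)^`() * T + euler_poly a * ('X * T^`()) =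
            'X * (euler_poly a * T - 1)^`().
    by rewrite derivB derivC derivM; ring.
  rewrite Eq derivM mulrDr dvdp_add//; first by rewrite mulrA dvdp_mull.
  rewrite derivXn -mulr_natr [X in _ %| X](_ : _ = q * (k.+1)%:R * 'X^(k.+1)) ?dvdp_mull//.
  by rewrite exprS; ring.
have main : 'X^(k.+1) %| 'X * T^`() - psum_poly k.+1 a * T.
  apply: (@dvdXn_euler_mul _ a).
  have := dvdp_sub XET (dvdp_mulr T (euler_poly_deriv k a)).
  by congr (_ %| _); ring.
move/dvdXnP: main => /(_ k (ltnSn k)) /eqP; rewrite coefB subr_eq0 => /eqP.
rewrite coefXM; case: k @T {ET XET} => [|k] T; first by rewrite mul0r big_ord0.
rewrite /= coef_deriv coef_poly ltnSn mulr_natl => ->.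
rewrite coefM big_ord_recl coef_poly/= mul0r add0r.
apply: eq_bigr => i _; rewrite /bump/= add1n coef_poly ltnS ltn_ord.
by rewrite coef_poly ltnS leq_subr.
Qed.

End Newton.

(** Both sides are coefficients of $-X E'/E$, which sees only $E$. Exponent 0 is excluded:
    [psum a 0] also counts zero parameters, which $E$ ignores. *)
Lemma eq_psum (K : fieldType) (I J : finType) (a : I -> K) (b : J -> K) :
  euler_poly a = euler_poly b -> forall k, (0 < k)%N -> psum a k = psum b k.
Proof.
move=> Eab [//|k] _.
have /dvdXn_euler_mul/dvdXnP/(_ k.+1 (ltnSn _)) :
    'X^(k.+2) %| euler_poly a * (psum_poly k.+2 a - psum_poly k.+2 b).
  have := euler_poly_deriv k.+1 b; rewrite -Eab => Db.
  have := dvdp_sub (euler_poly_deriv k.+1 a) Db.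
  by congr (_ %| _); ring.
by rewrite coefB !coef_poly ltnSn/= => /eqP; rewrite subr_eq0 => /eqP.
Qed.

(** * Covariances *)

(** The form $A - 2\,\mathrm{Re}(\bar t B) + |t|^2 D$ is tested at its minimum $t = B/D$. This
    serves both for covariances and for the Cauchy-Schwarz inequality in $L^2$. *)
Lemma hermitian_discriminant (C : numClosedFieldType) (A B D : C) :
  0 <= D ->
  (forall t, 0 <= A - t * B^* - t^* * B + t * t^* * D) -> `|B| ^+ 2 <= A * D.
Proof.
move=> D0 H; have A0 : 0 <= A.
  by have := H 0; rewrite conjC0 !mul0r !subr0 addr0.
have [D_eq0|D_neq0] := eqVneq D 0.
  have [->|B0] := eqVneq B 0; first by rewrite normr0 expr0n mulr_ge0.
  (* For $D = 0$ the form is affine over the reals; this [r] brings its value at [r * B] to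
     $-(A+2)$, which is negative. *)
  pose r := (A + 1) / `|B| ^+ 2.
  have rr : r^* = r by rewrite geC0_conj// divr_ge0 ?addr_ge0 ?exprn_ge0.
  have := H (r * B); rewrite rmorphM/= rr D_eq0 mulr0 addr0.
  have -> : r * B * B^* = A + 1.
    by rewrite -mulrA -normCK divfK// expf_neq0// normr_eq0.
  have -> : r * B^* * B = A + 1.
    by rewrite -mulrA (mulrC _ B) -normCK divfK// expf_neq0// normr_eq0.
  have -> : A - (A + 1) - (A + 1) = - (A + 2) by ring.
  rewrite oppr_ge0 => A2; have : 0 < A + 2 by rewrite ltr_wpDl.
  by rewrite lt_neqAle eq_sym => /andP[/negP[]]; rewrite eq_le A2 addr_ge0.
have Dp : 0 < D by rewrite lt_def D_neq0.
have := H (B / D); rewrite rmorphM/= (geC0_conj (_ : 0 <= D^-1)) ?invr_ge0//.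
have -> : A - B / D * B^* - B^* / D * B + B / D * (B^* / D) * D =
          A - B * B^* / D by field.
by rewrite -normCK subr_ge0 ler_pdivrMr.
Qed.

Section Covariance.
Context (C : numClosedFieldType).
Implicit Types (u v c a b : C) (s : seq (C * C * C)).

(* The list is a finite probability space carrying random variables X and Y: its
   entries are the triples (weight, value of X, value of Y). *)
Definition moments u v c a b : Prop :=
  exists s : seq (C * C * C),
    [/\ forall x, x \in s -> 0 <= x.1.1,
        \sum_(x <- s) x.1.1 = 1,
        u = \sum_(x <- s) x.1.1 * x.1.2 /\ v = \sum_(x <- s) x.1.1 * x.2,
        c = \sum_(x <- s) x.1.1 * (x.1.2 * x.2) &
        a = \sum_(x <- s) x.1.1 * `|x.1.2| ^+ 2 /\
        b = \sum_(x <- s) x.1.1 * `|x.2| ^+ 2].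

Lemma moments1 : moments 1 1 1 1 1.
Proof.
exists [:: (1, 1, 1)]; rewrite !big_seq1/= normr1 expr1n !mulr1; split => //.
by move=> x; rewrite inE => /eqP ->/=.
Qed.

(** On the product of the two probability spaces the two pairs of variables are independent, so the
    moments of the products factor. *)
Lemma momentsM u v c a b u' v' c' a' b' :
  moments u v c a b -> moments u' v' c' a' b' ->
  moments (u * u') (v * v') (c * c') (a * a') (b * b').
Proof.
move=> [s [s0 s1 [-> ->] -> [-> ->]]] [t [t0 t1 [-> ->] -> [-> ->]]].
exists [seq (x.1.1 * y.1.1, x.1.2 * y.1.2, x.2 * y.2) | x <- s, y <- t].
have E (f g h : C * C * C -> C) :
    (forall x y, h (x.1.1 * y.1.1, x.1.2 * y.1.2, x.2 * y.2) = f x * g y) ->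
    (\sum_(x <- s) f x) * (\sum_(x <- t) g x) =
    \sum_(x <- [seq (x.1.1 * y.1.1, x.1.2 * y.1.2, x.2 * y.2) | x <- s, y <- t]) h x.
  move=> hfg; rewrite big_allpairs_dep/= big_distrlr/=.
  by apply: eq_bigr => x _; apply: eq_bigr => y _; rewrite hfg.
split; first by move=> _ /allpairsP[[x y] /= [/s0 x0 /t0 y0 ->]]; exact: mulr_ge0.
- by rewrite -(E (fun x => x.1.1) (fun x => x.1.1)) ?s1 ?t1 ?mulr1.
- by split; apply: E => x y /=; ring.
- by apply: E => x y /=; ring.
- by split; apply: E => x y /=; rewrite normrM; ring.
Qed.

(** Nonnegativity of $E|X_0 - t\,\overline{Y_0}|^2$ for the centred variables $X_0$, $Y_0$ and every
    $t$. The conjugate on $Y_0$ is there because [c] is the mean of $XY$, not of $X\overline{Y}$. *)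
Lemma moments_cov u v c a b : moments u v c a b ->
  `|c - u * v| ^+ 2 <= (a - `|u| ^+ 2) * (b - `|v| ^+ 2).
Proof.
move=> [s [s0 s1 [-> ->] -> [-> ->]]].
set u0 := \sum_(_ <- _) (_ * _.1.2); set v0 := \sum_(_ <- _) (_ * _.2).
pose X (x : C * C * C) := x.1.2 - u0; pose Y (x : C * C * C) := x.2 - v0.
have w0 x : x \in s -> x.1.1^* = x.1.1 by move=> /s0; exact: geC0_conj.
have var (Z : C * C * C -> C) z : z = \sum_(x <- s) x.1.1 * Z x ->
    \sum_(x <- s) x.1.1 * `|Z x| ^+ 2 - `|z| ^+ 2 =
    \sum_(x <- s) x.1.1 * `|Z x - z| ^+ 2.
  move=> zE; have zcE : z^* = \sum_(x <- s) x.1.1 * (Z x)^*.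
    rewrite zE rmorph_sum big_seq [RHS]big_seq; apply: eq_bigr => x xs.
    by rewrite rmorphM/= w0.
  transitivity (\sum_(x <- s) (x.1.1 * `|Z x| ^+ 2 - z^* * (x.1.1 * Z x)
       - z * (x.1.1 * (Z x)^*) + z * z^* * x.1.1)).
    rewrite big_split/= !sumrB -!mulr_sumr -zE -zcE s1 normCK; ring.
  by apply: eq_bigr => x _; rewrite !normCK rmorphB/=; ring.
rewrite (var (fun x => x.1.2))// (var (fun x => x.2))// -/X -/Y.
have -> : \sum_(x <- s) x.1.1 * (x.1.2 * x.2) - u0 * v0 =
    \sum_(x <- s) x.1.1 * (X x * Y x).
  transitivity (\sum_(x <- s) (x.1.1 * (x.1.2 * x.2) - v0 * (x.1.1 * x.1.2)
       - u0 * (x.1.1 * x.2) + u0 * v0 * x.1.1)).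
    by rewrite big_split/= !sumrB -!mulr_sumr s1 -/u0 -/v0; ring.
  by apply: eq_bigr => x _; rewrite /X /Y; ring.
apply: hermitian_discriminant.
  by rewrite big_seq; apply: sumr_ge0 => x xs; rewrite mulr_ge0 ?exprn_ge0 ?s0.
move=> t.
suff -> : \sum_(x <- s) x.1.1 * `|x.1.2 - u0| ^+ 2
    - t * (\sum_(x <- s) x.1.1 * (X x * Y x))^*
    - t^* * (\sum_(x <- s) x.1.1 * (X x * Y x))
    + t * t^* * (\sum_(x <- s) x.1.1 * `|x.2 - v0| ^+ 2) =
    \sum_(x <- s) x.1.1 * `|X x - t * (Y x)^*| ^+ 2.
  by rewrite big_seq; apply: sumr_ge0 => x xs; rewrite mulr_ge0 ?exprn_ge0 ?s0.
have -> : (\sum_(x <- s) x.1.1 * (X x * Y x))^* =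
    \sum_(x <- s) x.1.1 * ((X x)^* * (Y x)^*).
  rewrite rmorph_sum big_seq [RHS]big_seq; apply: eq_bigr => x xs.
  by rewrite !rmorphM/= w0.
rewrite !mulr_sumr -!sumrB -big_split/=; apply: eq_bigr => x _.
by rewrite !normCK /X /Y !rmorphB !rmorphM/= !rmorphB/= !conjCK; ring.
Qed.

Lemma moments_prod (I : eqType) (r : seq I) (u v c a b : I -> C) :
  (forall i, i \in r -> moments (u i) (v i) (c i) (a i) (b i)) ->
  moments (\prod_(i <- r) u i) (\prod_(i <- r) v i) (\prod_(i <- r) c i)
          (\prod_(i <- r) a i) (\prod_(i <- r) b i).
Proof.
elim: r => [|i r IH] H; first by rewrite !big_nil; exact: moments1.
rewrite !big_cons; apply: momentsM; first by apply: H; rewrite mem_head.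
by apply: IH => j jr; apply: H; rewrite in_cons jr orbT.
Qed.

(* The list describes the law of the cycle type of a uniform random permutation
   of k letters. *)
Lemma newton_expansion k : exists s : seq (C * seq nat),
  [/\ forall x, x \in s -> 0 <= x.1 /\ all (ltn 0) x.2, \sum_(x <- s) x.1 = 1 &
   forall p h : nat -> C, h 0%N = 1 ->
     (forall k, k%:R * h k = \sum_(i < k) p i.+1 * h (k - i.+1)%N) ->
     h k = \sum_(x <- s) x.1 * \prod_(i <- x.2) p i].
Proof.
elim/ltn_ind: k => -[|k] IH.
  exists [:: (1, [::])]; rewrite big_seq1; split => //.
    by move=> x; rewrite inE => /eqP ->.
  by move=> p h h0 _; rewrite big_seq1/= big_nil mulr1.
have IH' (i : 'I_k.+1) := IH _ (leq_subr i k : (k - i < k.+1)%N).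
have [S HS] := boolp.choice IH'.
pose w : C := k.+1%:R^-1; have w0 : (k.+1%:R : C) != 0 by rewrite pnatr_eq0.
(* The cycle through a fixed letter has a length uniform in $1, \dots, k+1$, and the remaining
   letters carry a uniform permutation. *)
exists [seq (w * y.1, (nat_of_ord x).+1 :: y.2) | x <- enum 'I_k.+1, y <- S x].
split.
- move=> _ /allpairsPdep[i [y [_ yS ->]]] /=.
  have [/(_ _ yS)[y0 y1] _ _] := HS i; split => //.
  by rewrite mulr_ge0// invr_ge0 ler0n.
- rewrite big_allpairs_dep/= big_enum/=.
  under eq_bigr => i _ do rewrite -mulr_sumr (let: And3 _ h _ := HS i in h) mulr1.
  by rewrite sumr_const card_ord -mulr_natr mulVf.
- move=> p h h0 hk; apply: (mulfI w0); rewrite hk big_allpairs_dep/= big_enum/=.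
  rewrite mulr_sumr; apply: eq_bigr => i _.
  have [_ _ /(_ p h h0 hk) HSi] := HS i; rewrite subSS HSi !mulr_sumr.
  by apply: eq_bigr => y _; rewrite big_cons /= /w !mulrA divff// mul1r mulrAC; ring.
Qed.
End Covariance.

(** * Local Euler factors as moments *)

Section LocalFactors.
Context (C : numClosedFieldType).

Lemma psum_conj (I : finType) (a : I -> C) k :
  psum (fun j => (a j)^*) k = (psum a k)^*.
Proof. by rewrite /psum rmorph_sum; apply: eq_bigr => j _; rewrite rmorphXn. Qed.

Lemma psum_prod (I J : finType) (a : I -> C) (b : J -> C) k :
  psum (fun x : I * J => a x.1 * b x.2) k = psum a k * psum b k.
Proof.
rewrite /psum big_distrlr /= pair_big /=.
by apply: eq_bigr => x _; rewrite exprMn.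
Qed.

(** The condition of [local_coeffs], with the power of the prime replaced by its exponent. *)
Definition inverse_series (E : {poly C}) (L : nat -> C) : Prop :=
  forall k, \sum_(i < k.+1) E`_i * L (k - i)%N = (k == 0%N)%:R.

Lemma inverse_series0 (I : finType) (a : I -> C) L :
  inverse_series (euler_poly a) L -> L 0%N = 1.
Proof. by move/(_ 0%N); rewrite big_ord1 coef_euler_poly0 mul1r. Qed.

(** One law of cycle types serves all five series; only the power sum attached to a cycle varies.
    The parameters [ta] and [tb] enter through their Euler polynomials, since Satake parameters are
    determined only up to order; cycle lengths are positive, so [eq_psum] recovers the power
    sums. *)
Lemma rankin_selberg_moments (I J : finType) (a ta : I -> C) (b tb : J -> C)
    (La Lb Lab Laa Lbb : nat -> C) k :
  euler_poly ta = euler_poly (fun j => (a j)^*) ->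
  euler_poly tb = euler_poly (fun j => (b j)^*) ->
  inverse_series (euler_poly a) La -> inverse_series (euler_poly b) Lb ->
  inverse_series (euler_poly (fun x : I * J => a x.1 * b x.2)) Lab ->
  inverse_series (euler_poly (fun x : I * I => a x.1 * ta x.2)) Laa ->
  inverse_series (euler_poly (fun x : J * J => b x.1 * tb x.2)) Lbb ->
  moments (La k) (Lb k) (Lab k) (Laa k) (Lbb k).
Proof.
move=> Ea Eb iLa iLb iLab iLaa iLbb.
have [s [s0 s1 Hs]] := newton_expansion C k.
have expand (H : finType) (c : H -> C) L : inverse_series (euler_poly c) L ->
    L k = \sum_(x <- s) x.1 * \prod_(i <- x.2) psum c i.
  move=> iL; apply: Hs => [|m]; first exact: inverse_series0 iL.
  exact: newton iL m.
have norm (H : finType) (c tc : H -> C) x :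
    euler_poly tc = euler_poly (fun j => (c j)^*) -> x \in s ->
    \prod_(i <- x.2) psum (fun y : H * H => c y.1 * tc y.2) i =
    `|\prod_(i <- x.2) psum c i| ^+ 2.
  move=> Ec /s0[_ /allP x0]; rewrite normr_prod -prodrXl.
  rewrite big_seq [RHS]big_seq; apply: eq_bigr => i /x0 i0.
  by rewrite psum_prod (eq_psum Ec) // psum_conj normCK.
exists [seq (x.1, \prod_(i <- x.2) psum a i, \prod_(i <- x.2) psum b i) | x <- s].
split; rewrite ?big_map//=.
- by move=> _ /mapP[x /s0[x0 _] ->].
- by rewrite (expand _ _ _ iLa) (expand _ _ _ iLb).
- rewrite (expand _ _ _ iLab); apply: eq_bigr => x _.
  by rewrite -big_split/=; under eq_bigr do rewrite psum_prod.
- rewrite (expand _ _ _ iLaa) (expand _ _ _ iLbb).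
  by split; rewrite big_seq [RHS]big_seq; apply: eq_bigr => x xs /=; rewrite norm.
Qed.

End LocalFactors.

(** Vieta's formula. Hecke eigenvalues give the elementary symmetric functions of the Satake
    parameters, and this turns them into the Euler polynomial. *)
Lemma euler_poly_elsym (K : fieldType) n (a : 'I_n -> K) :
  euler_poly a = \sum_(r < n.+1)
    ((-1) ^+ r * \sum_(A : {set 'I_n} | #|A| == r) \prod_(i in A) a i) *: 'X^r.
Proof.
rewrite /euler_poly; under eq_bigr do rewrite addrC.
rewrite bigA_distr/=.
have cardA (A : {set 'I_n}) : (#|A| < n.+1)%N.
  by rewrite ltnS -[n in (_ <= n)%N]card_ord max_card.
rewrite (partition_big (fun A => Ordinal (cardA A)) predT)//=.
apply: eq_bigr => r _; rewrite mulr_sumr scaler_suml; apply: eq_big => A.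
  by [].
move=> /eqP <- /=; rewrite -big_mkcond/= -scalerA -mul_polyC.
rewrite (eq_bigr (fun i => (-1) * ((a i)%:P * 'X))); last by move=> i _; rewrite mulN1r.
rewrite !big_split/= !prodr_const rmorphXn/= rmorphN1; congr (_ * _).
by rewrite -mul_polyC rmorph_prod.
Qed.

(** * Square-integrable complex functions *)

Lemma ae_imply_on d (T : measurableType d) (R : realType)
    (mu : {measure set T -> \bar R}) (D : set T) (P Q : T -> Prop) :
  (forall x, P x -> Q x) ->
  {ae mu, forall x, D x -> P x} -> {ae mu, forall x, D x -> Q x}.
Proof. by move=> PQ; apply: filterS => x /[apply] /PQ. Qed.

Section ComplexL2.
Context d (T : measurableType d) (R : realType) (mu : {measure set T -> \bar R}).
Context (D : set T) (mD : measurable D).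
Local Notation C := R[i].
Local Notation Re := complex.Re.
Local Notation Im := complex.Im.
Implicit Types (f g h : T -> C) (a : C).

Definition cmeas f : Prop :=
  measurable_fun D (fun x => Re (f x)) /\ measurable_fun D (fun x => Im (f x)).

Definition csqint f : \bar R :=
  (\int[mu]_(x in D) (Normc.normc (f x) ^+ 2)%:E)%E.

Definition cL2 f : Prop := cmeas f /\ (csqint f < +oo)%E.

Definition cint f : C :=
  ((\int[mu]_(x in D) Re (f x)) +i* (\int[mu]_(x in D) Im (f x)))%C.

Definition cintegrable f : Prop :=
  mu.-integrable D (EFin \o (fun x => Re (f x))) /\
  mu.-integrable D (EFin \o (fun x => Im (f x))).

Definition cip f g : C := cint (fun x => f x * (g x)^*).

Lemma normcE2 (z : C) : Normc.normc z ^+ 2 = Re z ^+ 2 + Im z ^+ 2.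
Proof. by case: z => x y /=; rewrite sqr_sqrtr// addr_ge0// sqr_ge0. Qed.

Lemma cmeas_sqnorm f : cmeas f ->
  measurable_fun D (fun x => Normc.normc (f x) ^+ 2).
Proof.
move=> [fr fi]; under eq_fun do rewrite normcE2.
by apply: measurable_funD; exact: measurable_funX.
Qed.

Lemma cmeasM f g : cmeas f -> cmeas g -> cmeas (fun x => f x * g x).
Proof.
move=> [fr fi] [gr gi]; split.
- rewrite (_ : (fun _ => _) = fun x => Re (f x) * Re (g x) - Im (f x) * Im (g x)).
    by apply: measurable_funB; exact: measurable_funM.
  by apply/funext => x; case: (f x) (g x) => [? ?] [? ?].
- rewrite (_ : (fun _ => _) = fun x => Re (f x) * Im (g x) + Im (f x) * Re (g x)).
    by apply: measurable_funD; exact: measurable_funM.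
  by apply/funext => x; case: (f x) (g x) => [? ?] [? ?].
Qed.

Lemma conjcE (z : C) : z^* = (Re z -i* Im z)%C.
Proof. by case: z. Qed.

Lemma cmeas_conj f : cmeas f -> cmeas (fun x => (f x)^*).
Proof.
move=> [fr fi]; split.
  by rewrite (_ : (fun _ => _) = fun x => Re (f x))//; apply/funext => x; rewrite conjcE.
rewrite (_ : (fun _ => _) = fun x => - Im (f x)); first exact: measurable_funN.
by apply/funext => x; rewrite conjcE.
Qed.

Lemma cmeas_cst a : cmeas (fun=> a).
Proof. by split; exact: measurable_cst. Qed.

Lemma cmeasD f g : cmeas f -> cmeas g -> cmeas (fun x => f x + g x).
Proof.
move=> [fr fi] [gr gi]; split.
- rewrite (_ : (fun _ => _) = fun x => Re (f x) + Re (g x)).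
    exact: measurable_funD.
  by apply/funext => x; case: (f x) (g x) => [? ?] [? ?].
- rewrite (_ : (fun _ => _) = fun x => Im (f x) + Im (g x)).
    exact: measurable_funD.
  by apply/funext => x; case: (f x) (g x) => [? ?] [? ?].
Qed.

Lemma cL2_sqnorm_integrable f : cL2 f ->
  mu.-integrable D (EFin \o (fun x => Normc.normc (f x) ^+ 2)).
Proof.
move=> [mf foo]; apply/integrableP; split.
  by apply/measurable_EFinP; exact: cmeas_sqnorm.
apply: le_lt_trans foo; rewrite le_eqVlt; apply/orP; left; apply/eqP.
by apply: eq_integral => x _ /=; rewrite ger0_norm// sqr_ge0.
Qed.

Lemma cL2_dominated f g (h : T -> R) : cL2 f -> cL2 g -> measurable_fun D h ->
  (forall x, `|h x| <= Normc.normc (f x) ^+ 2 + Normc.normc (g x) ^+ 2) ->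
  mu.-integrable D (EFin \o h).
Proof.
move=> f2 g2 mh hfg.
apply: (@le_integrable _ _ _ mu D mD _
  (EFin \o (fun x => Normc.normc (f x) ^+ 2 + Normc.normc (g x) ^+ 2))).
- exact/measurable_EFinP.
- move=> x _ /=; rewrite lee_fin (le_trans (hfg x))//.
  by rewrite ger0_norm// addr_ge0// sqr_ge0.
- exact: (integrableD mD (cL2_sqnorm_integrable f2) (cL2_sqnorm_integrable g2)).
Qed.

Lemma cip_integrable f g : cL2 f -> cL2 g ->
  cintegrable (fun x => f x * (g x)^*).
Proof.
move=> f2 g2; have [mf _] := f2; have [mg _] := g2.
have [mr mi] := cmeasM mf (cmeas_conj mg).
have h (y z : R) : - (y ^+ 2 + z ^+ 2) <= 2 * (y * z) <= y ^+ 2 + z ^+ 2.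
  by have := sqr_ge0 (y - z); have := sqr_ge0 (y + z); rewrite sqrrB sqrrD; lra.
split; apply: cL2_dominated f2 g2 _ _ => //.
- move=> x; rewrite conjcE !normcE2; case: (f x) (g x) => [a b] [c e] /=.
  rewrite ler_norml; have /andP[? ?] := h a c; have /andP[? ?] := h b e; lra.
- move=> x; rewrite conjcE !normcE2; case: (f x) (g x) => [a b] [c e] /=.
  rewrite ler_norml; have /andP[? ?] := h a e; have /andP[? ?] := h b c; lra.
Qed.

Lemma cL2_lincomb a f g : cL2 f -> cL2 g -> cL2 (fun x => a * f x + g x).
Proof.
move=> f2 g2; have [mf foo] := f2; have [mg goo] := g2.
have mfg : cmeas (fun x => a * f x + g x).
  by apply: cmeasD => //; apply: cmeasM => //; exact: cmeas_cst.
(* From $|af+g|^2 \le 2(|a|^2|f|^2 + |g|^2)$, which is at most [M] times $|f|^2 + |g|^2$. *)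
split => //; pose M := (1 + Normc.normc a ^+ 2) *+ 2.
have M0 : 0 <= M by rewrite mulrn_wge0// addr_ge0// sqr_ge0.
have [mf2 mg2] := (cmeas_sqnorm mf, cmeas_sqnorm mg).
apply: (@le_lt_trans _ _ (M%:E * (csqint f + csqint g))%E); last first.
  by rewrite lte_mul_pinfty// lte_add_pinfty.
rewrite -ge0_integralD//; last 4 first.
- by move=> x _; rewrite lee_fin sqr_ge0.
- exact/measurable_EFinP.
- by move=> x _; rewrite lee_fin sqr_ge0.
- exact/measurable_EFinP.
rewrite -ge0_integralZl//; last 2 first.
- by apply: emeasurable_funD; exact/measurable_EFinP.
- by move=> x _; rewrite adde_ge0// lee_fin sqr_ge0.
apply: ge0_le_integral => //.
- by move=> x _; rewrite lee_fin sqr_ge0.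
- by apply/measurable_EFinP; exact: cmeas_sqnorm.
- apply: emeasurable_funM => //.
  by apply: emeasurable_funD; exact/measurable_EFinP.
- move=> x _; rewrite -EFinD -EFinM lee_fin /M !normcE2.
  case: (f x) (g x) a {M M0 mfg} => [u v] [s t] [p q] /=.
  have sq2 (y z : R) : (y + z) ^+ 2 <= (y ^+ 2 + z ^+ 2) *+ 2.
    by have := sqr_ge0 (y - z); rewrite sqrrB sqrrD !mulr2n; lra.
  apply: (le_trans (lerD (sq2 _ _) (sq2 _ _))).
  rewrite -mulrnDl mulrnAl lerMn2r/=.
  have -> : (p * u - q * v) ^+ 2 + s ^+ 2 + ((p * v + q * u) ^+ 2 + t ^+ 2) =
     (p ^+ 2 + q ^+ 2) * (u ^+ 2 + v ^+ 2) + (s ^+ 2 + t ^+ 2) by ring.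
  have : 0 <= (p ^+ 2 + q ^+ 2) * (s ^+ 2 + t ^+ 2).
    by rewrite mulr_ge0// addr_ge0// sqr_ge0.
  by have := sqr_ge0 u; have := sqr_ge0 v; lra.
Qed.

Lemma cint_lin a f g : cintegrable f -> cintegrable g ->
  cint (fun x => a * f x + g x) = a * cint f + cint g.
Proof.
move=> [fr fi] [gr gi]; rewrite /cint; case: a => p q.
have iZ (c : R) (h : T -> R) : mu.-integrable D (EFin \o h) ->
    mu.-integrable D (EFin \o (fun x => c * h x)).
  move=> hi; rewrite (_ : _ \o _ = fun x => (c%:E * (EFin \o h) x)%E)//.
  exact: integrableZl.
have iD (h k : T -> R) : mu.-integrable D (EFin \o h) ->
    mu.-integrable D (EFin \o k) -> mu.-integrable D (EFin \o (fun x => h x + k x)).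
  by move=> hi ki; apply: (integrableD mD hi ki).
rewrite (_ : (fun x => Re _) = fun x => (p * Re (f x) + (- q) * Im (f x)) + Re (g x)); last first.
  by apply/funext => x; case: (f x) (g x) => [? ?] [? ?]/=; rewrite mulNr.
rewrite (_ : (fun x => Im _) = fun x => (p * Im (f x) + q * Re (f x)) + Im (g x)); last first.
  by apply/funext => x; case: (f x) (g x) => [? ?] [? ?].
rewrite !RintegralD ?RintegralZl//; do ?[exact: iZ|apply: iD => //; exact: iZ].
by simpc.
Qed.

Lemma eq_cint f g : (forall x, D x -> f x = g x) -> cint f = cint g.
Proof.
by move=> fg; rewrite /cint; congr (_ +i* _)%C; apply: eq_Rintegral => x /set_mem/fg ->.
Qed.

Lemma ae_eq_cint f g : cmeas f -> cmeas g ->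
  {ae mu, forall x, D x -> f x = g x} -> cint f = cint g.
Proof.
move=> [fr fi] [gr gi] fg; rewrite /cint /Rintegral; congr (fine _ +i* fine _)%C.
- apply: ae_eq_integral => //; try exact/measurable_EFinP.
  by apply: filterS fg => x /[apply] ->.
- apply: ae_eq_integral => //; try exact/measurable_EFinP.
  by apply: filterS fg => x /[apply] ->.
Qed.

Lemma cip_linl a f g h : cL2 f -> cL2 g -> cL2 h ->
  cip (fun x => a * f x + g x) h = a * cip f h + cip g h.
Proof.
move=> f2 g2 h2; rewrite /cip -cint_lin; try exact: cip_integrable.
by apply: eq_cint => x _; rewrite mulrDl mulrA.
Qed.

Lemma cip_conj f g : cL2 f -> cL2 g -> cip g f = (cip f g)^*.
Proof.
move=> f2 g2; have [fr fi] := cip_integrable f2 g2.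
rewrite /cip /cint conjcE/=; congr (_ +i* _)%C.
  by apply: eq_Rintegral => x _; rewrite !conjcE; case: (f x) (g x) => [? ?] [? ?] /=; ring.
rewrite -mulN1r -RintegralZl//.
by apply: eq_Rintegral => x _; rewrite !conjcE; case: (f x) (g x) => [? ?] [? ?] /=; ring.
Qed.

Lemma cip_linr a f g h : cL2 f -> cL2 g -> cL2 h ->
  cip h (fun x => a * f x + g x) = a^* * cip h f + cip h g.
Proof.
move=> f2 g2 h2; rewrite cip_conj//; last exact: cL2_lincomb.
by rewrite cip_linl// rmorphD rmorphM/= -!cip_conj.
Qed.

Lemma cip_sqint f : cip f f = ((fine (csqint f))%:C)%C.
Proof.
rewrite /cip /cint; congr (_ +i* _)%C.
  congr fine; apply: eq_integral => x _; rewrite normcE2 conjcE.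
  by case: (f x) => a b /=; congr EFin; ring.
rewrite (_ : (fun _ => _) = fun=> 0); last first.
  by apply/funext => x; rewrite conjcE; case: (f x) => a b /=; ring.
by rewrite Rintegral_cst// mul0r.
Qed.

Lemma csqint_ge0 f : (0 <= csqint f)%E.
Proof. by apply: integral_ge0 => x _; rewrite lee_fin sqr_ge0. Qed.

Lemma cip_ge0 f : 0 <= cip f f.
Proof. by rewrite cip_sqint lecR fine_ge0// csqint_ge0. Qed.

(** [hermitian_discriminant] applied to the squared norm of $f - t g$. *)
Lemma cip_CauchySchwarz f g : cL2 f -> cL2 g ->
  `|cip f g| ^+ 2 <= cip f f * cip g g.
Proof.
move=> f2 g2; apply: hermitian_discriminant; first exact: cip_ge0.
move=> t; have := cip_ge0 (fun x => - t * g x + f x).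
have L2l := cL2_lincomb (- t) g2 f2.
rewrite cip_linl// !cip_linr// rmorphN /= (cip_conj f2 g2).
by congr (_ <= _); ring.
Qed.

Lemma ae_eq_cip f g h : cL2 f -> cL2 g -> cL2 h ->
  {ae mu, forall x, D x -> f x = g x} -> cip h f = cip h g.
Proof.
move=> [mf _] [mg _] [mh _] fg; apply: ae_eq_cint.
- by apply: cmeasM => //; exact: cmeas_conj.
- by apply: cmeasM => //; exact: cmeas_conj.
- by apply: filterS fg => x /[apply] ->.
Qed.

Lemma cip_eq0 f : cL2 f -> cip f f = 0 <-> {ae mu, forall x, D x -> f x = 0}.
Proof.
move=> [mf foo]; have mf2 := cmeas_sqnorm mf.
have -> : cip f f = 0 <-> (\int[mu]_(x in D) `|(Normc.normc (f x) ^+ 2)%:E| = 0)%E.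
  rewrite cip_sqint (_ : (\int[mu]_(x in D) _)%E = csqint f); last first.
    by apply: eq_integral => x _; rewrite gee0_abs// lee_fin sqr_ge0.
  split=> [[/eqP]|->//]; rewrite fine_eq0; first by move/eqP.
  by rewrite ge0_fin_numE// csqint_ge0.
rewrite ae_eq_integral_abs//; last exact/measurable_EFinP.
split; apply: filterS => x /[apply].
  by move=> [] /eqP; rewrite expf_eq0/= => /eqP /Normc.eq0_normc.
by move=> ->; rewrite /cst normcE2/= expr0n addr0.
Qed.

End ComplexL2.

(** * Integrals of equally distributed functions *)

Section EqualDistribution.
Import numFieldNormedType.Exports.
Context d (T : measurableType d) (R : realType) (mu : {measure set T -> \bar R}).
Context (D : set T) (mD : measurable D) (f g : T -> R).
Context (mf : measurable_fun D f) (mg : measurable_fun D g).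
Context (fg : forall B, measurable B ->
  mu (D `&` f @^-1` B) = mu (D `&` g @^-1` B)).

Let mfD : measurable_fun setT (f \_ D). Proof. by apply/(measurable_restrictT _ mD). Qed.
Let mgD : measurable_fun setT (g \_ D). Proof. by apply/(measurable_restrictT _ mD). Qed.

(** Extension by 0 outside [D] moves the mass of the complement of [D] to the value 0, in the same
    way for [f] and for [g]. *)
Let preimage_restrictE (h : T -> R) B : measurable_fun D h -> measurable B ->
  mu ((h \_ D) @^-1` B) =
  (mu (D `&` h @^-1` B) + mu (if 0%R \in B then ~` D else set0))%E.
Proof.
move=> mh mB.
have -> : (h \_ D) @^-1` B =
    (D `&` h @^-1` B) `|` (if 0%R \in B then ~` D else set0).
  apply/seteqP; split => x; rewrite /preimage /= patchE.
    case: ifPn => [/set_mem Dx Bx|/negP xD B0]; first by left.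
    by right; rewrite mem_set// => Dx; apply: xD; exact: mem_set.
  case=> [[Dx Bx]|]; first by rewrite mem_set.
  by case: ifPn => // /set_mem B0 nDx; rewrite memNset.
rewrite measureU//.
- exact: mh.
- by case: ifPn => // _; exact: measurableC.
- apply/seteqP; split => // x [[Dx _]].
  by case: ifPn => // _; apply.
Qed.

Let ge0_eq_integral (phi : R -> \bar R) : measurable_fun setT phi ->
  (forall y, 0 <= phi y)%E ->
  (\int[mu]_x phi ((f \_ D) x) = \int[mu]_x phi ((g \_ D) x))%E.
Proof.
move=> mphi phi0.
transitivity (\int[pushforward mu (f \_ D)]_y phi y)%E.
  by rewrite (ge0_integral_pushforward mfD)//; exact: measurable_funTS.
transitivity (\int[pushforward mu (g \_ D)]_y phi y)%E; last first.
  by rewrite (ge0_integral_pushforward mgD)//; exact: measurable_funTS.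
apply: (@eq_measure_integral _ _ _ setT
  (measure_function_pushforward__canonical__measure_function_Measure mu mgD)
  (measure_function_pushforward__canonical__measure_function_Measure mu mfD)).
move=> B mB _; rewrite /= /pushforward.
by rewrite !preimage_restrictE// fg.
Qed.

(** Positive and negative parts become integrals over the real line against the laws of [f] and [g]
    extended by 0, and these laws agree. *)
Lemma equal_distribution_integral :
  (\int[mu]_(x in D) (f x)%:E = \int[mu]_(x in D) (g x)%:E)%E.
Proof.
rewrite integral_mkcond [RHS]integral_mkcond.
have E (h : T -> R) : (EFin \o h) \_ D = EFin \o (h \_ D).
  by apply/funext => x; rewrite /= !patchE; case: ifP.
rewrite (E f) (E g) integralE [RHS]integralE; congr (_ - _)%E.
- rewrite unlock; apply: (ge0_eq_integral (phi := (fun y : R => maxe y%:E 0)%E)).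
    by apply: measurable_maxe => //; exact: measurable_EFin.
  by move=> y; rewrite le_max lexx orbT.
- rewrite unlock; apply: (ge0_eq_integral (phi := (fun y : R => maxe (- y%:E) 0)%E)).
    apply: measurable_maxe => //; apply: measurableT_comp => //; exact: measurable_EFin.
  by move=> y; rewrite le_max lexx orbT.
Qed.

End EqualDistribution.

Section CipPreserved.
Context d (T : measurableType d) (R : realType) (mu : {measure set T -> \bar R}).
Context (D : set T) (mD : measurable D) (tau : T -> T).
Context (tau_preserves : forall h : T -> R,
  measurable_fun D h -> measurable_fun D (h \o tau) ->
  forall B, measurable B ->
    mu (D `&` (h \o tau) @^-1` B) = mu (D `&` h @^-1` B)).

(** Only the composites with [tau] are assumed measurable, not [tau]. Hence the hypothesis speaks of
    preimages under [h \o tau], and the change of variables is replaced by equality of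
    distributions. *)
Lemma cip_preserved (f g : T -> R[i]) :
  cmeas D f -> cmeas D g -> cmeas D (f \o tau) -> cmeas D (g \o tau) ->
  cip mu D (f \o tau) (g \o tau) = cip mu D f g.
Proof.
move=> mf mg mft mgt.
have [mr mi] := cmeasM mf (cmeas_conj mg).
have [mrt mit] := cmeasM mft (cmeas_conj mgt).
rewrite /cip /cint /Rintegral; congr (fine _ +i* fine _)%C.
  by apply: equal_distribution_integral => // B mB; exact: (tau_preserves mr mrt).
by apply: equal_distribution_integral => // B mB; exact: (tau_preserves mi mit).
Qed.

End CipPreserved.

(** * Non-archimedean absolute values *)

Section FinitePlace.
Context (R : realType) (F : fieldExtType rat) (p : finplace F).
Context (Kp : completion (inl p : place R F)).
Local Notation L := (cfield Kp).
Local Notation w := (@cabs R F _ Kp).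
Local Notation emb := (cemb Kp).
Implicit Types (x y : L) (a : F).

Lemma cabs0 : w 0 = 0. Proof. exact/cabs_eq0. Qed.

Lemma cabs_neq0 x : x != 0 -> w x != 0.
Proof. by apply: contra => /eqP/cabs_eq0 ->. Qed.

Lemma cabs1 : w 1 = 1.
Proof.
apply: (mulfI (cabs_neq0 (oner_neq0 L))).
by rewrite -cabsM !mulr1.
Qed.

Lemma cabsX x k : w (x ^+ k) = w x ^+ k.
Proof. by elim: k => [|k IH]; rewrite ?cabs1// !exprS cabsM IH. Qed.

Lemma cabsN1 : w (-1) = 1.
Proof.
apply/eqP; rewrite -(@eqrXn2 _ 2)//; first last.
  exact: cabs_ge0.
by rewrite expr1n -cabsX sqrrN expr1n cabs1.
Qed.

Lemma cabsN x : w (- x) = w x.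
Proof. by rewrite -mulN1r cabsM cabsN1 mul1r. Qed.

Lemma cabsV x : x != 0 -> w x^-1 = (w x)^-1.
Proof.
by move=> x0; apply: (mulfI (cabs_neq0 x0)); rewrite -cabsM !divff ?cabs1// cabs_neq0.
Qed.

Lemma cabs_emb_le1 a : ring_of_integers F a -> w (emb a) <= 1.
Proof.
move=> Oa; have := cabs_emb Kp => /(_ a 0%N Oa).
by rewrite expr0 invr1 => -[_]; apply.
Qed.

Lemma cabs_nat_le1 k : w k%:R <= 1.
Proof.
by rewrite -(rmorph_nat emb); apply: cabs_emb_le1; exact: integral_nat.
Qed.

(** If $t = 1 + s$ with $s > 0$, Bernoulli's inequality gives $t^{2k} \ge (1 + ks)^2$, and quadratic
    growth beats the linear bound. *)
Lemma bounded_powers_le1 (t M : R) :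
  0 <= t -> (forall k, t ^+ k <= M * k.+1%:R) -> t <= 1.
Proof.
move=> t0 Ht; rewrite leNgt; apply/negP => t1.
pose s := t - 1; have s0 : 0 < s by rewrite subr_gt0.
have Bern k : 1 + k%:R * s <= t ^+ k.
  elim: k => [|k IH]; first by rewrite mul0r addr0 expr0.
  rewrite exprS; apply: (@le_trans _ _ (t * (1 + k%:R * s))); last by rewrite ler_wpM2l.
  have : 0 <= k%:R * s * s by rewrite !mulr_ge0// ltW.
  by rewrite /s -natr1; lra.
have M0 : 0 <= M by have := Ht 0%N; rewrite expr0 mulr1; apply: le_trans.
(* With such a $k \ge 1$, $M(2k+1) \le 3Mk < k^2 s^2$. *)
have [k hk] : exists k, 3 * M / s ^+ 2 < k%:R.
  exists (Num.bound (3 * M / s ^+ 2)); rewrite archi_boundP//.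
  by rewrite divr_ge0 ?sqr_ge0// mulr_ge0.
have k0 : (0 < k%:R :> R).
  by apply: le_lt_trans hk; rewrite divr_ge0 ?sqr_ge0// mulr_ge0.
have k1 : (1 <= k%:R :> R) by move: k0; rewrite ltr0n ler1n.
have := Ht (k * 2)%N; rewrite exprM => H.
have H1 : (1 + k%:R * s) ^+ 2 <= (t ^+ k) ^+ 2.
  by rewrite lerXn2r ?nnegrE ?exprn_ge0// addr_ge0// mulr_ge0// ltW.
have := le_trans H1 H; rewrite -natr1 natrM.
move: hk; rewrite ltr_pdivrMr ?exprn_gt0// => hk.
have : 3 * M * k%:R < k%:R * s ^+ 2 * k%:R by rewrite ltr_pM2r.
have : 0 < k%:R * s by rewrite mulr_gt0.
have : M <= M * k%:R by rewrite ler_peMr.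
by rewrite !expr2; lra.
Qed.

Lemma cabs_sum (I : Type) (r : seq I) (f : I -> L) :
  w (\sum_(i <- r) f i) <= \sum_(i <- r) w (f i).
Proof.
elim/big_rec2: _ => [|i b x _ h]; first by rewrite cabs0.
by apply: (le_trans (cabsD _ _)); rewrite lerD2l.
Qed.

(** The key to the ultrametric inequality, as [completion] provides only the triangle inequality.
    Integers have absolute value at most 1, so the $k+1$ binomial terms bound $|1+x|^k$ by $k+1$. *)
Lemma cabs_add1_le1 x : w x <= 1 -> w (1 + x) <= 1.
Proof.
move=> x1; apply: (@bounded_powers_le1 _ 1) => [|k]; first exact: cabs_ge0.
rewrite -cabsX exprDn; apply: (le_trans (cabs_sum _ _)).
have -> : 1 * k.+1%:R = \sum_(i < k.+1) (1 : R) by rewrite sumr_const card_ord mul1r.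
apply: ler_sum => i _.
rewrite expr1n mul1r -mulr_natl cabsM cabsX mulr_ile1//; do ?exact: cabs_ge0.
- exact: exprn_ge0 (cabs_ge0 _).
- exact: cabs_nat_le1.
- by rewrite exprn_ile1// cabs_ge0.
Qed.

Lemma cabsD_le_max x y : w (x + y) <= Num.max (w x) (w y).
Proof.
wlog xy : x y / w x <= w y => [H|].
  have /orP[/H//|/H] := le_total (w x) (w y); by rewrite addrC maxC.
rewrite (max_idPr _)//.
have [y0|y0] := eqVneq y 0.
  by move: xy; rewrite y0 addr0.
have -> : x + y = y * (1 + x / y) by rewrite mulrDr mulr1 mulrC divfK// addrC.
rewrite cabsM ger_pMr ?lt_def ?cabs_neq0 ?cabs_ge0//.
by apply: cabs_add1_le1; rewrite cabsM cabsV// ler_pdivrMr ?mul1r ?lt_def ?cabs_neq0 ?cabs_ge0.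
Qed.

Lemma cabsD_le1 x y : w x <= 1 -> w y <= 1 -> w (x + y) <= 1.
Proof. by move=> x1 y1; apply: (le_trans (cabsD_le_max _ _)); rewrite ge_max x1. Qed.

Lemma cabs_sum_le1 (I : Type) (r : seq I) (P : pred I) (f : I -> L) :
  (forall i, P i -> w (f i) <= 1) -> w (\sum_(i <- r | P i) f i) <= 1.
Proof.
move=> H; elim/big_ind: _ => [||//]; first by rewrite cabs0.
exact: cabsD_le1.
Qed.

Lemma cabs_sum_lt1 (I : Type) (r : seq I) (P : pred I) (f : I -> L) :
  (forall i, P i -> w (f i) < 1) -> w (\sum_(i <- r | P i) f i) < 1.
Proof.
move=> H; elim/big_ind: _ => [||//]; first by rewrite cabs0.
by move=> x y x1 y1; apply: (le_lt_trans (cabsD_le_max _ _)); rewrite gt_max x1.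
Qed.

Lemma cabs_prod (I : Type) (r : seq I) (P : pred I) (f : I -> L) :
  w (\prod_(i <- r | P i) f i) = \prod_(i <- r | P i) w (f i).
Proof. by elim/big_rec2: _ => [|i b x _ <-]; rewrite ?cabs1 ?cabsM. Qed.

Lemma cabs_prod_le1 (I : Type) (r : seq I) (P : pred I) (f : I -> L) :
  (forall i, P i -> w (f i) <= 1) -> w (\prod_(i <- r | P i) f i) <= 1.
Proof.
move=> H; elim/big_ind: _ => [||//]; first by rewrite cabs1.
by move=> x y x1 y1; rewrite cabsM mulr_ile1// cabs_ge0.
Qed.

Lemma cabs_sign k : w ((-1) ^+ k) = 1.
Proof. by rewrite cabsX cabsN1 expr1n. Qed.

Lemma cabs_det_le1 n (g : 'M[L]_n) : (forall i j, w (g i j) <= 1) -> w (\det g) <= 1.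
Proof.
move=> H; apply: cabs_sum_le1 => s _.
by rewrite cabsM cabs_sign mul1r cabs_prod_le1.
Qed.

(** If [w x] exceeded 1, dividing the equation by the leading power of [x] would write $-1$ as a sum
    of terms of absolute value below 1. *)
Lemma monic_root_le1 (q : {poly L}) x : q \is monic -> root q x ->
  (forall i, w q`_i <= 1) -> w x <= 1.
Proof.
move=> qm qx q1; rewrite leNgt; apply/negP => x1.
have x0 : x != 0 by apply: contraTneq x1 => ->; rewrite cabs0 ltr10.
have [k sq] : exists k, size q = k.+1.
  by exists (size q).-1; rewrite prednK// lt0n size_poly_eq0 monic_neq0.
have qk : q`_k = 1 by move: qm; rewrite monicE lead_coefE sq => /eqP.
have : x ^+ k = - \sum_(i < k) q`_i * x ^+ i.
  move: qx; rewrite rootE horner_coef sq big_ord_recr/= qk mul1r => /eqP.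
  by rewrite addrC => /eqP; rewrite addr_eq0 => /eqP.
move/(congr1 (fun z => w (z / x ^+ k))); rewrite divff ?expf_neq0// cabs1.
rewrite mulNr cabsN mulr_suml => /esym/eqP; apply/negP; rewrite lt_eqF//.
apply: cabs_sum_lt1 => i _; rewrite -mulrA !cabsM cabsV ?expf_neq0// !cabsX.
have wx : 0 < w x := lt_trans ltr01 x1.
apply: (@le_lt_trans _ _ (1 * (w x ^+ i / w x ^+ k))).
  by rewrite ler_wpM2r// divr_ge0// exprn_ge0// ltW.
by rewrite mul1r ltr_pdivrMr ?exprn_gt0// mul1r ltr_eXn2l.
Qed.

Lemma ideal_exp1 (a : set F) : integral_ideal a -> ideal_exp a 1 = a.
Proof.
move=> [aO a0 aD aM]; apply/seteqP; split => x.
  move=> [m [y [z [ay Oz ->]]]].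
  elim/big_ind: _ => //; first by move=> i _; rewrite mulrC; apply: aM.
move=> ax; exists 1%N, (fun=> x), (fun=> 1); split => [//|_|].
  exact: integral1.
by rewrite big_ord1 mulr1.
Qed.

(** By the convention on [fset_set], the norm would be 0 if there were infinitely many cosets. The
    completion excludes this: a nonzero element of the prime has a positive absolute value bounded
    by the inverse of the norm, and the inverse of 0 is 0. *)
Lemma ideal_norm_gt0 : 0 < ((ideal_norm (sval p))%:R : R).
Proof.
have [[ip [a pa a0]] p1 pP] := svalP p.
have Oa : ring_of_integers F a by case: ip => + _ _ _; apply.
have := cabs_emb Kp => /(_ a 1%N Oa)[_]; rewrite ideal_exp1// => /(_ pa).
have : 0 < w (emb a) by rewrite lt_def cabs_neq0 ?fmorph_eq0// cabs_ge0.
by move=> + h => /lt_le_trans/(_ h); rewrite expr1 invr_gt0.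
Qed.

(** No power of [a] lies in the prime, so all powers of [w (emb a)] exceed $N^{-1}$. The powers of
    its inverse are thus bounded by $N$, which forces the inverse to be at most 1. *)
Lemma cabs_emb_unit a : ring_of_integers F a -> ~ sval p a -> w (emb a) = 1.
Proof.
move=> Oa pa; apply/eqP; rewrite eq_le cabs_emb_le1//= leNgt; apply/negP => a1.
have [[ip _] p1 pP] := svalP p.
have O k : ring_of_integers F (a ^+ k).
  by elim: k => [|k IH]; [exact: integral1|rewrite exprS; exact: integral_mul].
have pk k : ~ sval p (a ^+ k).
  elim: k => [//|k IH]; by rewrite exprS => /(pP _ _ Oa (O k))[].
have N0 := ideal_norm_gt0; set N : R := _%:R in N0.
have big k : N^-1 < w (emb a) ^+ k.
  rewrite ltNge; apply/negP => h; apply: (pk k).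
  have := cabs_emb Kp => /(_ _ 1%N (O k))[+ _].
  by rewrite ideal_exp1// expr1 rmorphXn cabsX; apply.
have a0 : 0 < w (emb a) by have := big 1%N; apply: lt_trans; rewrite invr_gt0.
have : (w (emb a))^-1 <= 1.
  apply: (@bounded_powers_le1 _ N) => [|k]; first by rewrite invr_ge0 ltW.
  apply: (@le_trans _ _ N); last by rewrite ler_peMr ?ler1n// ltW.
  by rewrite exprVn invf_ple ?posrE ?exprn_gt0// ltW.
by rewrite invf_cp1 ?unitf_gt0//= leNgt a1.
Qed.

End FinitePlace.

(** * Primes above a rational integer *)

Section FinitelyManyPrimes.
Context (F : fieldExtType rat).
Local Notation OF := (ring_of_integers F).
Implicit Types (p q : set F) (x y : F).

Lemma OF_int (z : int) : OF z%:~R.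
Proof. exact: integral_id. Qed.

Lemma OF_horner (f : {poly int}) y : OF y -> OF (map_poly intr f).[y].
Proof.
move=> Oy; elim/poly_ind: f => [|f c IH].
  by rewrite rmorph0 horner0; exact: mxpoly.integral0.
rewrite rmorphD rmorphM/= map_polyX map_polyC/= hornerMXaddC.
apply: integral_add; [exact: integral_mul|exact: integral_id].
Qed.

Lemma ideal_sub p x y : integral_ideal p -> p x -> p y -> p (x - y).
Proof.
move=> [_ _ pD pM] px py; apply: pD => //; rewrite -mulN1r; apply: pM => //.
by rewrite (_ : -1 = (-1 : int)%:~R); [exact: OF_int|rewrite rmorphN1].
Qed.

Lemma prime_over_dvdz p (l : nat) (z : int) : nonzero_prime p -> prime l ->
  p l%:R -> p z%:~R -> (l %| z)%Z.
Proof.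
move=> [[[_ _ pD pM] _] p1 _] lp pl pz; apply: contrapT => /negP nlz; apply: p1.
have /coprimezP[[u v]/= uv] : coprimez l z.
  by rewrite coprimezE absz_nat prime_coprime.
rewrite (_ : 1 = u%:~R * l%:R + v%:~R * z%:~R).
  by apply: pD; apply: pM => //; exact: OF_int.
by rewrite -[l%:R]/(l%:~R) -!intrM -intrD uv.
Qed.

(** For [y] in [q], start from a monic integral polynomial with $f(y)$ in [p]. Its constant term
    lies in [q], hence is divisible by [l] and lies in [p]. Removing it leaves a multiple of [y] in
    [p], so either [y] is in [p] or the degree drops. *)
Lemma prime_over_maximal p q (l : nat) : nonzero_prime p -> nonzero_prime q ->
  prime l -> p l%:R -> p `<=` q -> q `<=` p.
Proof.
move=> pp qq lp pl pq y qy.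
have [[[pO p0 pD pM] _] p1 pP] := pp.
have [[iq _] q1 qP] := qq; have [qO q0 qD qM] := iq.
have Oy := qO _ qy.
have [f fm fy] := Oy.
have {fy} : p (map_poly intr f).[y] by move: fy => /eqP ->.
elim/poly_ind: f fm => [|f c IH]; first by rewrite monicE lead_coef0 eq_sym oner_eq0.
have Of := OF_horner f Oy.
rewrite rmorphD rmorphM/= map_polyX map_polyC/= hornerMXaddC => fm pfy.
have [f0|f0] := eqVneq f 0.
  move: fm pfy; rewrite f0 rmorph0 horner0 !mul0r !add0r monicE lead_coefC => /eqP ->.
  by rewrite rmorph1 => /p1.
have {}fm : f \is monic.
  move: fm; rewrite !monicE lead_coefDl ?lead_coefMX//.
  by rewrite size_mulX// (leq_ltn_trans (size_polyC_leq1 _))// ltnS size_poly_gt0.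
have qc : q c%:~R.
  rewrite (_ : c%:~R = (map_poly intr f).[y] * y + c%:~R - (map_poly intr f).[y] * y).
    by apply: ideal_sub => //; [exact: pq|exact: qM].
  by rewrite addrAC subrr add0r.
have /dvdzP[e ce] : (l %| c)%Z.
  by apply: prime_over_dvdz qc => //; exact: pq.
have pc : p c%:~R by rewrite ce intrM; apply: pM => //; exact: OF_int.
have := ideal_sub (let: conj h _ := let: And3 h _ _ := pp in h in h) pfy pc.
rewrite addrK => /(pP _ _ Of Oy)[|//].
exact: IH.
Qed.

Lemma prime_prod (I : Type) (r : seq I) (P : pred I) p (f : I -> F) :
  nonzero_prime p -> (forall i, P i -> OF (f i)) ->
  p (\prod_(i <- r | P i) f i) -> exists2 i, P i & p (f i).
Proof.
move=> [_ p1 pP] Of.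
suff : OF (\prod_(i <- r | P i) f i) /\
  (p (\prod_(i <- r | P i) f i) -> exists2 i, P i & p (f i)) by case.
elim/big_rec: _ => [|i x Pi [Ox IH]]; first by split=> [|/p1]; [exact: integral1|].
split=> [|/(pP _ _ (Of i Pi) Ox)[pf|/IH//]]; last by exists i.
by apply: integral_mul => //; exact: Of.
Qed.

(* If the p_i are distinct primes above l, then elements e_i lying in every p_j
   except p_i are linearly independent over the rationals: in a primitive
   integral relation the i-th coefficient lies in p_i, hence is divisible by
   l. *)
Lemma finite_primes_over (l : nat) : prime l ->
  finite_set [set p : set F | nonzero_prime p /\ p l%:R].
Proof.
move=> lp; apply: contrapT => /(@infinite_set_fset _ _ (\dim {:F}).+1)[B Bp Bsize].
pose d := \dim {:F}.
pose P (i : 'I_d.+1) := nth set0 (enum_fset B) i.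
have PB i : P i \in B by rewrite mem_nth// (leq_trans _ Bsize).
have Pinj : injective P.
  move=> i j /eqP; rewrite nth_uniq ?fset_uniq// ?(leq_trans (ltn_ord _) Bsize)//.
  by move=> /eqP/val_inj.
have Pp i : nonzero_prime (P i) by have [] := Bp _ (PB i).
have Pl i : P i l%:R by have [] := Bp _ (PB i).
have POF i x : P i x -> OF x by have [[[+ _ _ _] _] _ _] := Pp i; apply.
(* By maximality, distinct primes above [l] are separated: [a (i, j)] lies in [P j] and not in
   [P i]. Diagonal values are arbitrary. *)
have /boolp.choice[a aP] (ij : 'I_d.+1 * 'I_d.+1) :
    exists x, ij.1 <> ij.2 -> P ij.2 x /\ ~ P ij.1 x.
  have [ij0|ij0] := pselect (ij.1 = ij.2); first by exists 0.
  apply: contrapT => /forallNP H; apply: ij0; apply: Pinj.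
  have sub : P ij.2 `<=` P ij.1.
    move=> x p2x; apply: contrapT => p1x; apply: (H x) => _; by split.
  by apply/seteqP; split => //; exact: (prime_over_maximal (Pp _) (Pp _) lp (Pl _) sub).
pose e i := \prod_(j | j != i) a (i, j).
have Oa i j : j != i -> OF (a (i, j)).
  by move=> /eqP ji; apply: (POF j); apply: (aP (i, j) _).1 => /esym.
have Oe i : OF (e i).
  rewrite /e; elim/big_ind: _ => [||j ji]; first exact: integral1.
    by move=> x y; exact: integral_mul.
  exact: Oa.
have ei i : ~ P i (e i).
  move=> /(prime_prod (Pp i))[|j ji]; first by move=> j; exact: Oa.
  by apply: (aP (i, j) _).2 => /= /esym; apply/eqP.
have ej i j : j != i -> P j (e i).
  move=> ji; rewrite /e (bigD1 j)//= mulrC.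
  have [[[_ _ _ pM] _] _ _] := Pp j; apply: pM.
    elim/big_ind: _ => [||k /andP[ki _]]; first exact: integral1.
      by move=> x y; exact: integral_mul.
    exact: Oa.
  by apply: (aP (i, j) _).1 => /= /esym; apply/eqP.
pose X := [tuple e i | i < d.+1].
have : ~~ free X.
  apply/negP => fX; have := dimvS (subvf <<X>>).
  by rewrite (eqP (fX : _ == _)) size_tuple ltnn.
move=> /freeP/existsNP[k /not_implyP[kX /existsNP[i0 ki0]]].
(* Packaging the rational relation as a polynomial lets one clear denominators and divide by the
   content, leaving a primitive integral relation [z]. *)
pose Q := \poly_(i < d.+1) k (inord i).
have Qk i : Q`_(val i) = k i by rewrite coef_poly ltn_ord inord_val.
have [q [b b0 Qq]] := rat_poly_scale Q.
have q0 : q != 0.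
  apply/eqP => q0; apply: ki0; rewrite -Qk Qq q0 rmorph0 scaler0 coef0//.
pose z := zprimitive q.
have zk i : k i = (b%:~R^-1 * (zcontents q)%:~R) * (z`_(val i))%:~R.
  rewrite -Qk Qq coefZ coef_map/= {1}[q]zpolyEprim coefZ intrM mulrA//.
have c0 : b%:~R^-1 * (zcontents q)%:~R != 0 :> rat.
  by rewrite mulf_neq0 ?invr_eq0 ?intr_eq0// zcontents_eq0.
have rel : \sum_i (z`_(val i))%:~R * e i = 0.
  have := kX; under eq_bigr do rewrite (nth_mktuple _ _ _) zk -scalerA.
  rewrite -scaler_sumr => /eqP; rewrite scaler_eq0 (negPf c0)/= => /eqP kX0.
  by rewrite -[RHS]kX0; apply: eq_bigr => i _; rewrite scaler_int mulrzl.
have lz (i : 'I_d.+1) : (l %| z`_(val i))%Z.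
  apply: (@prime_over_dvdz (P i) l z`_(val i) (Pp i) lp (Pl i)).
  have [[iP _] _ pP] := Pp i; have [_ p0 pD pM] := iP.
  suff /(pP _ _ (OF_int _) (Oe i))[//|/ei//] : P i ((z`_(val i))%:~R * e i).
  move: rel; rewrite (bigD1 i)//= => /eqP; rewrite addr_eq0 => /eqP ->.
  rewrite -[- _]add0r; apply: ideal_sub => //.
  elim/big_ind: _ => // j ji; apply: pM; first exact: OF_int.
  by apply: ej; rewrite eq_sym.
have : (l %| zcontents z)%Z.
  rewrite dvdz_contents; apply/polyOverP => i.
  have [id|id] := ltnP i d.+1; first exact: (lz (Ordinal id)).
  rewrite nth_default ?dvdz0//.
  suff : (size z <= d.+1)%N by move/leq_trans; apply.
  rewrite size_zprimitive.
  have -> : size q = size Q.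
    by rewrite Qq size_scale ?invr_eq0 ?intr_eq0// size_map_poly_id0// intr_eq0 lead_coef_eq0.
  exact: size_poly.
rewrite zcontents_primitive q0 dvdz1 absz_nat.
by move: lp => /prime_gt1; case: l {Pl lz Bp} => [|[]].
Qed.

(** Strong induction on [m]: a prime ideal containing [m] contains the least prime factor of [m] or
    the cofactor. *)
Lemma finite_primes_containing (m : nat) : (0 < m)%N ->
  finite_set [set p : set F | nonzero_prime p /\ p m%:R].
Proof.
elim/ltn_ind: m => m IH m0.
have [m1|m1] := leqP m 1.
  have -> : m = 1%N by apply/eqP; rewrite eqn_leq m1.
  by rewrite [X in finite_set X](_ : _ = set0)//; apply/seteqP; split => // p [[_ + _]].
have lp := pdiv_prime m1; have lm := pdiv_dvd m.
apply: (@sub_finite_set _ _ ([set p : set F | nonzero_prime p /\ p (pdiv m)%:R] `|`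
   [set p : set F | nonzero_prime p /\ p (m %/ pdiv m)%:R])).
  move=> p [pp]; rewrite -{1}(divnK lm) natrM.
  have [_ _ pP] := pp; move/pP.
  by case=> [||?|?]; [exact: integral_nat|exact: integral_nat|right|left].
rewrite finite_setU; split; first exact: finite_primes_over.
apply: IH; first by rewrite ltn_Pdiv// prime_gt1.
by rewrite divn_gt0 ?prime_gt0// dvdn_leq.
Qed.

Lemma finite_places_containing (m : nat) : (0 < m)%N ->
  finite_set [set p : finplace F | sval p m%:R].
Proof.
move=> m0; have fin := finite_primes_containing m0.
have : finite_set ((@sval (set F) (@nonzero_prime F)) @^-1`
    [set p : set F | nonzero_prime p /\ p m%:R]).
  apply: finite_preimage fin => -[p pp] [q qp] _ _ /= pq.
  by move: pp qp; rewrite pq => pp qp; congr exist; exact: Prop_irrelevance.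
apply: sub_finite_set => p pm; split => //; exact: (svalP p).
Qed.
End FinitelyManyPrimes.

(** * The adelic general linear group *)

Section GLnAdeles.
Context (R : realType) (F : fieldExtType rat) (K : completions R F) (n : nat).
Implicit Types (g h : mxfam K n) (p : finplace F).
Local Notation GLA := (GLA K n).

Lemma cabs_mulmx_le1 p (a b : 'M[cfield (K (inl p))]_n) :
  (forall i j, cabs (a i j) <= 1) -> (forall i j, cabs (b i j) <= 1) ->
  forall i j, cabs ((a *m b) i j) <= 1.
Proof.
move=> a1 b1 i j; rewrite mxE; apply: cabs_sum_le1 => k _.
by rewrite cabsM mulr_ile1// cabs_ge0.
Qed.

Lemma GLO1 p : GLO (1%:M : 'M[cfield (K (inl p))]_n).
Proof.
split; last by rewrite det1 cabs1.
by move=> i j; rewrite mxE; case: (i == j); rewrite /= ?cabs1// cabs0 ler01.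
Qed.

Lemma GLOM p (a b : 'M[cfield (K (inl p))]_n) : GLO a -> GLO b -> GLO (a *m b).
Proof.
move=> [a1 da] [b1 db]; split; first exact: cabs_mulmx_le1.
by rewrite det_mulmx cabsM da db mulr1.
Qed.

Lemma GLO_unitmx p (a : 'M[cfield (K (inl p))]_n) : GLO a -> a \in unitmx.
Proof.
move=> [_ da]; rewrite unitmxE unitfE; apply: contra_eq_neq da => ->.
by rewrite cabs0 eq_sym oner_eq0.
Qed.

Lemma GLOV p (a : 'M[cfield (K (inl p))]_n) : GLO a -> GLO (invmx a).
Proof.
move=> aO; have ua := GLO_unitmx aO; have [a1 da] := aO.
have d0 : \det a != 0 by rewrite -unitfE -unitmxE.
split; last by rewrite det_inv cabsV// da invr1.
move=> i j; rewrite /invmx ua !mxE cabsM cabsV// da invr1 mul1r.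
rewrite cabsM cabs_sign mul1r; apply: cabs_det_le1 => k l.
by rewrite !mxE.
Qed.

Lemma mulmxfamA (a b c : mxfam K n) : mulf a (mulf b c) = mulf (mulf a b) c.
Proof. by apply/functional_extensionality_dep => v; rewrite /mulf mulmxA. Qed.

Definition mxfam1 : mxfam K n := fun=> 1%:M.
Definition mxfamV g : mxfam K n := fun v => invmx (g v).

Lemma mulmxfam1 g : mulf g mxfam1 = g.
Proof. by apply/functional_extensionality_dep => v; rewrite /mulf mulmx1. Qed.

Lemma mul1mxfam g : mulf mxfam1 g = g.
Proof. by apply/functional_extensionality_dep => v; rewrite /mulf mul1mx. Qed.

Lemma mulmxfamV g : GLA g -> mulf g (mxfamV g) = mxfam1.
Proof.
by move=> [ug _]; apply/functional_extensionality_dep => v; rewrite /mulf mulmxV ?ug.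
Qed.

Lemma mulVmxfam g : GLA g -> mulf (mxfamV g) g = mxfam1.
Proof.
by move=> [ug _]; apply/functional_extensionality_dep => v; rewrite /mulf mulVmx ?ug.
Qed.

Lemma GLA1 : GLA mxfam1.
Proof.
split; first by move=> v; exact: unitmx1.
rewrite [X in finite_set X](_ : _ = set0)//; apply/seteqP; split => // p.
by apply; exact: GLO1.
Qed.

Lemma GLAM g h : GLA g -> GLA h -> GLA (mulf g h).
Proof.
move=> [ug fg] [uh fh]; split; first by move=> v; rewrite /mulf unitmx_mul ug uh.
move: (conj fg fh); rewrite -finite_setU; apply: sub_finite_set => p /=.
by move=> H; apply/not_andP => -[a b]; apply: H; exact: GLOM.
Qed.

Lemma GLAV g : GLA g -> GLA (mxfamV g).
Proof.
move=> [ug fg]; split; first by move=> v; rewrite /mxfamV unitmx_inv ug.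
by apply: sub_finite_set fg => p /= H ?; apply: H; exact: GLOV.
Qed.

(** Away from the primes containing a denominator of the minimal polynomial of [x] over the
    rationals, that polynomial is monic with integral coefficients, and [monic_root_le1] applies. *)
Lemma finite_places_gt1 (x : F) :
  finite_set [set p : finplace F | ~ cabs (cemb (K (inl p)) x) <= 1].
Proof.
have /polyOver1P[q mq] := minPolyOver 1%AS x.
have qm : q \is monic by rewrite -(map_monic (in_alg F)) -mq monic_minPoly.
have qx : root (map_poly (in_alg F) q) x by rewrite -mq root_minPoly.
pose m := \prod_(i < size q) `|denq q`_i|%N.
have m0 : (0 < m)%N by apply: prodn_gt0 => i; rewrite absz_gt0 denq_neq0.
apply: sub_finite_set (finite_places_containing F m0) => p /=.
apply: contra_notP => pm; set emb := cemb _.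
apply: (@monic_root_le1 _ _ _ _ (map_poly emb (map_poly (in_alg F) q))).
- by rewrite !map_monic.
- by rewrite fmorph_root.
move=> i; rewrite !coef_map/=.
have [iq|iq] := ltnP i (size q); last by rewrite nth_default// scale0r rmorph0 cabs0 ler01.
set c := q`_i.
have num : (c%:A : F) * (denq c)%:~R = (numq c)%:~R.
  have E : c * (denq c)%:~R = (numq c)%:~R.
    by rewrite -{1}(divq_num_den c) divfK ?intr_eq0 ?denq_neq0.
  by have := congr1 (in_alg F) E; rewrite rmorphM !rmorph_int.
have den1 : cabs (emb (denq c)%:~R) = 1.
  apply: cabs_emb_unit; first exact: OF_int.
  move=> pd; apply: pm.
  have [[[_ _ _ pM] _] _ _] := svalP p.
  rewrite /m (bigD1 (Ordinal iq))//= natrM mulrC; apply: pM; first exact: integral_nat.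
  by move: pd; rewrite -(gez0_abs (ltW (denq_gt0 c))).
have := congr1 (fun z => cabs (emb z)) num; rewrite rmorphM cabsM den1 mulr1 => ->.
by apply: cabs_emb_le1; exact: OF_int.
Qed.

(** The entries of [gam], its determinant and the inverse of the determinant are integral at all but
    finitely many primes. *)
Lemma GLF_sub_GLA : GLF (K := K) (n := n) `<=` GLA.
Proof.
move=> g [gam ugam gE]; split; first by move=> v; rewrite gE map_unitmx.
apply: (@sub_finite_set _ _ (\bigcup_(x in [set x : F | x \in
   [:: \det gam; (\det gam)^-1] ++ [seq gam i.1 i.2 | i <- enum {: 'I_n * 'I_n}]])
   [set p : finplace F | ~ cabs (cemb (K (inl p)) x) <= 1])).
  move=> p /= nG; apply: contrapT => H; apply: nG.
  have le1 x : x \in [:: \det gam; (\det gam)^-1] ++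
      [seq gam i.1 i.2 | i <- enum {: 'I_n * 'I_n}] ->
      cabs (cemb (K (inl p)) x) <= 1.
    by move=> xs; apply: contrapT => nx; apply: H; exists x.
  rewrite gE; split.
    move=> i j; rewrite mxE; apply: le1; rewrite mem_cat; apply/orP; right.
    by apply/mapP; exists (i, j); rewrite ?mem_enum.
  have d0 : \det gam != 0 by rewrite -unitfE -unitmxE.
  rewrite det_map_mx; apply/eqP; rewrite eq_le le1 ?inE ?eqxx//=.
  have : cabs (cemb (K (inl p)) (\det gam)^-1) <= 1 by rewrite le1 ?inE ?eqxx ?orbT.
  rewrite fmorphV cabsV ?fmorph_eq0// invf_cp1 ?lt_def ?cabs_neq0 ?fmorph_eq0 ?cabs_ge0//.
apply: bigcup_finite => [|x _]; last exact: finite_places_gt1.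
exact: finite_seq.
Qed.

Lemma pos_idele_GLA z : pos_idele (K := K) z -> GLA (scalarf n z).
Proof.
move=> [t t0 [zp zw]]; have z0 v : z v != 0.
  case: v => [p|w]; first by rewrite zp oner_neq0.
  (* A rational number within $t/2$ of $t$ exceeds $t/2$, so it cannot be within $t/2$ of 0 at the
     place [w]. *)
  apply/eqP => zw0; have := zw w (t / 2); rewrite zw0 => /(_ _)[|q [qt qz]].
    by rewrite divr_gt0.
  move: qz; rewrite subr0 -(fmorph_rat (cemb (K (inr w)))).
  have := cabs_emb (K (inr w)) => /= ->.
  have [sigma ->] := svalP w; rewrite fmorph_rat.
  have -> : Normc.normc (ratr q : R[i]) = `|ratr q : R|.
    by rewrite -(fmorph_rat (real_complex R)) /Normc.normc/= expr0n addr0 sqrtr_sqr.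
  by move: qt; rewrite ltr_distl => /andP[] ? ? /ltr_normlW; lra.
split; first by move=> v; rewrite unitmxE det_scalar unitfE expf_neq0 ?z0.
rewrite [X in finite_set X](_ : _ = set0)//; apply/seteqP; split => // p /=.
by rewrite /scalarf zp; apply; exact: GLO1.
Qed.

(* The generators of the sigma-algebra are traces of left Gam-invariant open sets,
   so GLA itself is one only because a nonzero element of F is a unit at almost
   all primes. *)
Lemma GLA_measurable : measurable (GLA : set (quot_type (Gam K n) GLA)).
Proof.
apply: sub_gen_smallest; exists GLA; last by rewrite setIid.
split.
  by split => // g Gg; exists set0, 1; split => //.
move=> _ g [gam [z [/GLF_sub_GLA Ggam /pos_idele_GLA Gz ->]]] Gg.
by apply: GLAM => //; exact: GLAM.
Qed.

End GLnAdeles.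

(** * The maximal compact subgroup at a prime and its Hecke double cosets *)

Section MaximalCompact.
Context (R : realType) (F : fieldExtType rat) (K : completions R F) (n : nat).
Context (p : finplace F).
Implicit Types (g h : mxfam K n).
Local Notation GLA := (GLA K n).
Local Notation Kp := (@Kp R F K n p).

Lemma Kp_GLA : Kp `<=` GLA.
Proof. by move=> g [[]]. Qed.

Lemma Kp1 : Kp (@mxfam1 R F K n).
Proof. by split; [split => //; exact: GLA1|exact: GLO1]. Qed.

Lemma KpM g h : Kp g -> Kp h -> Kp (mulf g h).
Proof.
move=> [[Gg g1] gO] [[Gh h1] hO]; split; last exact: GLOM.
split; first exact: GLAM.
by move=> v vp; rewrite /Defs.mulf g1// h1// mulmx1.
Qed.

Lemma KpV g : Kp g -> Kp (mxfamV g).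
Proof.
move=> [[Gg g1] gO]; split; last exact: GLOV.
split; first exact: GLAV.
by move=> v vp; rewrite /mxfamV g1// invmx1.
Qed.

(** Some element of [q] is a unit at [p], so the congruence modulo [q] only asks for integrality
    there. Newvectors are therefore fixed by [Kp] at unramified primes. *)
Lemma Kp_sub_K1 (q : set F) : integral_ideal q -> ~ q `<=` sval p ->
  Kp `<=` @K1 R F K n q.
Proof.
move=> [qO q0 _ _] qp g [[Gg g1] gO]; split => //; first by move=> w; exact: g1.
move=> p'; have [->|pp'] := pselect (p' = p); last first.
  rewrite g1; last by move=> [].
  split; first exact: GLO1.
  by move=> i j _; exists 0 => //; rewrite mxE subrr rmorph0.
split => // i j _.
have [x qx px] : exists2 x, q x & ~ sval p x.
  by apply: contrapT => H; apply: qp => x qx; apply: contrapT => px; apply: H; exists x.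
exists x => //; rewrite cabs_emb_unit//; last exact: qO.
apply: cabsD_le1; first by case: gO.
by rewrite cabsN; case: (i == j); rewrite ?cabs1// cabs0 ler01.
Qed.

Lemma coset_reps_double t m (s : 'I_m -> mxfam K n) i :
  coset_reps Kp t s ->
  exists k1 k2, [/\ Kp k1, Kp k2 & s i = mulf (mulf k1 t) k2].
Proof.
move=> [sP _]; apply/sP; exists i, (@mxfam1 R F K n); split; first exact: Kp1.
by rewrite mulmxfam1.
Qed.

Lemma coset_reps_GLA t m (s : 'I_m -> mxfam K n) i : GLA t ->
  coset_reps Kp t s -> GLA (s i).
Proof.
move=> Gt /(coset_reps_double i)[k1 [k2 [/Kp_GLA G1 /Kp_GLA G2 ->]]].
by apply: GLAM => //; exact: GLAM.
Qed.

Lemma coset_reps_inj t m (s : 'I_m -> mxfam K n) t' m' (s' : 'I_m' -> mxfam K n) u :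
  Kp u -> t = mulf t' u -> coset_reps Kp t s -> coset_reps Kp t' s' ->
  exists2 f : 'I_m -> 'I_m', injective f & forall i, exists2 k, Kp k & s i = mulf (s' (f i)) k.
Proof.
move=> Ku tu cs cs'; have [_ sinj] := cs; have [s'P _] := cs'.
have H i : exists j, exists2 k, Kp k & s i = mulf (s' j) k.
  have [k1 [k2 [K1 K2 ->]]] := coset_reps_double i cs.
  have [] := (s'P (mulf (mulf k1 t) k2)).1.
    exists k1, (mulf u k2); split => //; first exact: KpM.
    by rewrite tu !mulmxfamA.
  by move=> j [k [Kk ->]]; exists j, k.
have [f fP] := boolp.choice H; exists f => // i j fij.
have [k Kk sik] := fP i; have [k' Kk' sjk'] := fP j.
apply: (sinj i j (mulf (mxfamV k) k')); first by apply: KpM => //; exact: KpV.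
rewrite sjk' sik -fij -mulmxfamA (mulmxfamA k) mulmxfamV ?mul1mxfam//.
exact: Kp_GLA.
Qed.

(** Both systems represent the same double coset. Sending a representative to the one of its coset
    gives injections both ways, hence a bijection of the index sets. *)
Lemma coset_reps_sum (T : nmodType) (f : mxfam K n -> T) t m (s : 'I_m -> mxfam K n)
    t' m' (s' : 'I_m' -> mxfam K n) u :
  Kp u -> t = mulf t' u -> GLA t' -> coset_reps Kp t s -> coset_reps Kp t' s' ->
  (forall g k, GLA g -> Kp k -> f (mulf g k) = f g) ->
  \sum_i f (s i) = \sum_i f (s' i).
Proof.
move=> Ku tu Gt' cs cs' fK.
have tu' : t' = mulf t (mxfamV u).
  by rewrite tu -mulmxfamA mulmxfamV ?mulmxfam1//; exact: Kp_GLA.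
have [a ainj aP] := coset_reps_inj Ku tu cs cs'.
have [b binj _] := coset_reps_inj (KpV Ku) tu' cs' cs.
have abij : bijective a.
  by apply: inj_card_bij => //; exact: leq_card binj.
rewrite [RHS](reindex a); last exact: onW_bij.
apply: eq_bigr => i _; have [k Kk ->] := aP i.
by rewrite fK//; exact: coset_reps_GLA cs'.
Qed.

(** The quotient of the two diagonal matrices is diagonal with unit entries. This reconciles the
    uniformizers chosen in [satakeP] for a representation and for its contragredient. *)
Lemma hecke_elt_unit x x' r t t' : cabs x = cabs x' -> x' != 0 ->
  @is_hecke_elt R F K n p x r t -> @is_hecke_elt R F K n p x' r t' ->
  exists2 u, Kp u & t = mulf t' u.
Proof.
move=> xx' x'0 [[Gt t1] tp] [[Gt' t1'] tp'].
have cx : cabs (x / x') = 1.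
  by rewrite cabsM cabsV// xx' divff// cabs_neq0.
exists (mulf (mxfamV t') t); last first.
  by rewrite mulmxfamA mulmxfamV// mul1mxfam.
split; first split.
- by apply: GLAM => //; exact: GLAV.
- by move=> v vp; rewrite /Defs.mulf /mxfamV t1// t1'// invmx1 mulmx1.
pose d : 'rV[cfield (K (inl p))]_n := \row_(i < n) (if (i < r)%N then x / x' else 1).
have -> : mulf (mxfamV t') t (inl p) = diag_mx d.
  have ut' := Gt'.1 (inl p); rewrite /Defs.mulf /mxfamV.
  apply: (can_inj (mulKmx ut')); rewrite mulKVmx// tp tp'.
  apply/matrixP => i j; rewrite mul_diag_mx !mxE.
  by case: eqP => [_|_]; rewrite ?mulr0n ?mulr0// !mulr1n; case: ifP; rewrite ?mulr1// mulrC divfK.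
split.
  move=> i j; rewrite !mxE; case: eqP => _; last by rewrite mulr0n cabs0 ler01.
  by rewrite mulr1n; case: ifP; rewrite ?cx ?cabs1.
rewrite det_diag cabs_prod big1// => i _; rewrite mxE.
by case: ifP; rewrite ?cabs1.
Qed.

End MaximalCompact.

(** * Contragredient representations *)

Section Representations.
Context (R : realType) (F : fieldExtType rat) (K : completions R F) (n : nat).
Context (am : autom_measure K n).
Local Notation mu := (am_measure am).
Local Notation C := R[i].
Local Notation GLA := (GLA K n).
Local Notation ip := (cip mu GLA).
Local Notation mD := (@GLA_measurable R F K n).
Implicit Types (g h : mxfam K n) (phi psi : mxfam K n -> C).
Implicit Types (V W : set (mxfam K n -> C)).

Lemma rtransM g h phi : rtrans (mulf g h) phi = rtrans g (rtrans h phi).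
Proof. by apply/funext => x; rewrite /rtrans mulmxfamA. Qed.

Lemma rtrans1 phi : rtrans (@mxfam1 R F K n) phi = phi.
Proof. by apply/funext => x; rewrite /rtrans mulmxfam1. Qed.

Lemma L2_cL2 phi : L2 mu phi -> cL2 mu GLA phi.
Proof. by case. Qed.

Lemma closed_subrep_cL2 V phi : closed_subrep mu V -> V phi -> cL2 mu GLA phi.
Proof. by move=> [VL2 _ _ _ _] /VL2; exact: L2_cL2. Qed.

(* Translation is not shown to be measurable: the measurability of the translated
   functions comes from the stability of V. *)
Lemma cip_rtrans V h phi psi : closed_subrep mu V -> GLA h -> V phi -> V psi ->
  ip (rtrans h phi) (rtrans h psi) = ip phi psi.
Proof.
move=> cV Gh Vphi Vpsi; have [_ _ _ Vr _] := cV.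
have tau (f : mxfam K n -> R) :
    measurable_fun (GLA : set (quot_type (Gam K n) GLA)) f ->
    measurable_fun (GLA : set (quot_type (Gam K n) GLA)) (f \o (fun g => mulf g h)) ->
    forall B, measurable B ->
    mu (GLA `&` (f \o (fun g => mulf g h)) @^-1` B) = mu (GLA `&` f @^-1` B).
  move=> mf mft B mB; have [_ inv] := am_measureP am.
  rewrite -(inv (GLA `&` (f \o (fun g => mulf g h)) @^-1` B) h)//.
  - congr (mu _); apply/seteqP; split => [_ [g [Gg fg] <-]|g [Gg fg]].
      by split => //; exact: GLAM.
    exists (mulf g (mxfamV h)).
      split; first by apply: GLAM => //; exact: GLAV.
      by rewrite /preimage/= -mulmxfamA mulVmxfam// mulmxfam1.
    by rewrite -mulmxfamA mulVmxfam// mulmxfam1.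
  - exact: (mft mD B mB).
have mV f : V f -> cmeas (GLA : set (quot_type (Gam K n) GLA)) f.
  by move=> /(closed_subrep_cL2 cV)[].
by apply: (cip_preserved mD tau); apply: mV => //; exact: Vr.
Qed.

Section Subrep.
Context (V : set (mxfam K n -> C)) (cV : closed_subrep mu V).

Lemma subrep_lincomb (a : C) phi psi : V phi -> V psi -> V (lincomb a phi psi).
Proof. by have [_ _ + _ _] := cV; apply. Qed.

Lemma subrep_rtrans h phi : GLA h -> V phi -> V (rtrans h phi).
Proof. by have [_ _ _ + _] := cV; apply. Qed.

Lemma subrep0 : V (fun=> 0). Proof. by have [] := cV. Qed.

Lemma subrepZ (a : C) phi : V phi -> V (fun g => a * phi g).
Proof.
move=> Vphi; have := subrep_lincomb a Vphi subrep0.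
by congr V; apply/funext => g; rewrite /lincomb addr0.
Qed.

Lemma subrep_sum (I : Type) (r : seq I) (f : I -> mxfam K n -> C) :
  (forall i, V (f i)) -> V (fun g => \sum_(i <- r) f i g).
Proof.
move=> Vf; elim: r => [|i r IH].
  by under eq_fun do rewrite big_nil; exact: subrep0.
have := subrep_lincomb 1 (Vf i) IH.
by congr V; apply/funext => g; rewrite /lincomb big_cons mul1r.
Qed.

Lemma cip0r psi : V psi -> ip psi (fun=> 0) = 0.
Proof.
move=> Vpsi; have VL2 := closed_subrep_cL2 cV.
have := cip_linr mD (-1) (VL2 _ subrep0) (VL2 _ subrep0) (VL2 _ Vpsi).
rewrite rmorphN1 (mulN1r (ip _ _)) addNr => h0; rewrite -[RHS]h0.
by apply: eq_cint => g _; rewrite mulr0 addr0.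
Qed.

Lemma cip_sumr (I : Type) (r : seq I) (f : I -> mxfam K n -> C) psi :
  V psi -> (forall i, V (f i)) ->
  ip psi (fun g => \sum_(i <- r) f i g) = \sum_(i <- r) ip psi (f i).
Proof.
move=> Vpsi Vf; have VL2 := closed_subrep_cL2 cV.
elim: r => [|i r IH].
  by rewrite big_nil -[RHS](cip0r Vpsi); apply: eq_cint => g _; rewrite big_nil.
rewrite big_cons -IH.
have := cip_linr mD 1 (VL2 _ (Vf i)) (VL2 _ (subrep_sum r Vf)) (VL2 _ Vpsi).
rewrite conjC1 (mul1r (ip _ _)) => <-; apply: eq_cint => g _.
by congr (_ * _^*); rewrite mul1r big_cons.
Qed.

Lemma cipZr (a : C) phi psi : V phi -> V psi ->
  ip psi (fun g => a * phi g) = a^* * ip psi phi.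
Proof.
move=> Vphi Vpsi; have VL2 := closed_subrep_cL2 cV.
have := cip_linr mD a (VL2 _ Vphi) (VL2 _ subrep0) (VL2 _ Vpsi).
rewrite cip0r// addr0.
by move=> <-; apply: eq_cint => g _; rewrite addr0.
Qed.

Lemma cip_rtransr h phi psi : GLA h -> V phi -> V psi ->
  ip (rtrans (mxfamV h) phi) psi = ip phi (rtrans h psi).
Proof.
move=> Gh Vphi Vpsi; rewrite -(cip_rtrans cV Gh (subrep_rtrans (GLAV Gh) Vphi) Vpsi).
by rewrite -rtransM mulmxfamV// rtrans1.
Qed.

End Subrep.

Lemma cuspidal_subrep V : cuspidal_automorphic mu V -> closed_subrep mu V.
Proof. by move=> [[]]. Qed.

Lemma normc_cip_le phi psi : cL2 mu GLA phi -> cL2 mu GLA psi ->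
  Normc.normc (ip phi psi) <= L2norm mu psi * L2norm mu phi.
Proof.
move=> phi2 psi2; have := cip_CauchySchwarz mD phi2 psi2.
rewrite !(cip_sqint _ mD) => CSC.
have CS : Normc.normc (ip phi psi) ^+ 2 <=
    fine (csqint mu GLA phi) * fine (csqint mu GLA psi).
  by rewrite -lecR rmorphXn rmorphM; exact: CSC.
have n0 : 0 <= Normc.normc (ip phi psi) by case: (ip _ _) => x y; exact: sqrtr_ge0.
rewrite -(ler_pXn2r (ltn0Sn 1)) ?nnegrE ?mulr_ge0 ?sqrtr_ge0//.
rewrite (le_trans CS)// exprMn mulrC /L2norm !sqr_sqrtr// fine_ge0//; exact: csqint_ge0.
Qed.

Section Contragredient.
Context (pi tpi : cusp_rep mu).
Local Notation V := (cspace pi).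
Local Notation W := (cspace tpi).
Let cV : closed_subrep mu V. Proof. exact: cuspidal_subrep (cspaceP pi). Qed.
Let cW : closed_subrep mu W. Proof. exact: cuspidal_subrep (cspaceP tpi). Qed.
Let VL2 phi : V phi -> cL2 mu GLA phi. Proof. exact: closed_subrep_cL2. Qed.
Let WL2 phi : W phi -> cL2 mu GLA phi. Proof. exact: closed_subrep_cL2. Qed.

(** [psi0] is the image of [phi0] under the Riesz identification of [V] with its dual [W]. This map
    is conjugate-linear, the source of the conjugate Satake parameters. *)
Definition dual_pair (B : (mxfam K n -> C) -> (mxfam K n -> C) -> C) phi0 psi0 : Prop :=
  [/\ V phi0, W psi0 & forall phi, V phi -> B phi psi0 = ip phi phi0].

Context (B : (mxfam K n -> C) -> (mxfam K n -> C) -> C).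
Context (Blinr : forall (a : C) phi psi1 psi2, V phi -> W psi1 -> W psi2 ->
           B phi (lincomb a psi1 psi2) = a * B phi psi1 + B phi psi2).
Context (Bbound : exists M : R, forall phi psi, V phi -> W psi ->
          Normc.normc (B phi psi) <= M * L2norm mu phi * L2norm mu psi).
Context (Binv : forall h phi psi, GLA h -> V phi -> W psi ->
          B (rtrans h phi) (rtrans h psi) = B phi psi).
Context (Bnondeg : forall psi, W psi -> (forall phi, V phi -> B phi psi = 0) ->
          ae_zero mu psi).
Context (Brep : forall l : (mxfam K n -> C) -> C,
          (forall (a : C) phi1 phi2, V phi1 -> V phi2 ->
             l (lincomb a phi1 phi2) = a * l phi1 + l phi2) ->
          (exists M : R, forall phi, V phi ->
             Normc.normc (l phi) <= M * L2norm mu phi) ->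
          exists2 psi, W psi & forall phi, V phi -> l phi = B phi psi).

Lemma exists_dual phi0 : V phi0 -> exists psi0, dual_pair B phi0 psi0.
Proof.
move=> Vphi0; have [||psi Wpsi ipB] := Brep (l := fun phi => ip phi phi0).
- by move=> a phi1 phi2 V1 V2; rewrite -(cip_linl mD)//; exact: VL2.
- exists (L2norm mu phi0) => phi Vphi.
  by apply: normc_cip_le; exact: VL2.
- by exists psi; split => // phi /ipB.
Qed.

(** Elements of [W] are functions, not classes; the boundedness of [B] makes it insensitive to null
    sets. *)
Lemma B_ae0 phi psi : V phi -> W psi -> ae_zero mu psi -> B phi psi = 0.
Proof.
move=> Vphi Wpsi psi0; have [M HM] := Bbound.
have := HM _ _ Vphi Wpsi; rewrite (_ : L2norm mu psi = 0).
  rewrite mulr0 => B0; apply: Normc.eq0_normc; apply/eqP; rewrite eq_le B0.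
  by case: (B _ _) => x y; exact: sqrtr_ge0.
have [_ /(_ psi0)] := cip_eq0 mD (WL2 Wpsi).
by rewrite (cip_sqint _ mD) /L2norm => -[->]; rewrite sqrtr0.
Qed.

Lemma B_ae_eq phi psi1 psi2 : V phi -> W psi1 -> W psi2 ->
  aeq mu psi1 psi2 -> B phi psi1 = B phi psi2.
Proof.
move=> Vphi W1 W2 E.
have := B_ae0 Vphi (subrep_lincomb cW (-1) W2 W1).
rewrite Blinr// mulN1r addrC => H; apply/eqP; rewrite -subr_eq0; apply/eqP/H.
apply: ae_imply_on E => g; rewrite /lincomb mulN1r addrC => ->.
by rewrite subrr.
Qed.

Lemma B0r phi : V phi -> B phi (fun=> 0) = 0.
Proof.
move=> Vphi; apply: B_ae0 => //; first exact: subrep0.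
exact: (@aeW _ (quot_type (Gam K n) GLA)).
Qed.

Lemma B_Zr (a : C) phi psi : V phi -> W psi -> B phi (fun g => a * psi g) = a * B phi psi.
Proof.
move=> Vphi Wpsi; have := Blinr a Vphi Wpsi (subrep0 cW); rewrite B0r// addr0 => <-.
by congr B; apply/funext => g; rewrite /lincomb addr0.
Qed.

Lemma B_sumr (I : Type) (r : seq I) (f : I -> mxfam K n -> C) phi :
  V phi -> (forall i, W (f i)) ->
  B phi (fun g => \sum_(i <- r) f i g) = \sum_(i <- r) B phi (f i).
Proof.
move=> Vphi Wf; elim: r => [|i r IH].
  by rewrite big_nil -[RHS](B0r Vphi); congr B; apply/funext => g; rewrite big_nil.
rewrite big_cons -IH; have := Blinr 1 Vphi (Wf i) (subrep_sum cW r Wf).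
rewrite mul1r => <-; congr B; apply/funext => g.
by rewrite /lincomb mul1r big_cons.
Qed.

Section DualPair.
Context (phi0 psi0 : mxfam K n -> C) (dual : dual_pair B phi0 psi0).

(** Duality commutes with translation: [B] is invariant and translation is unitary on [V]. *)
Lemma B_rtransr h phi : GLA h -> V phi ->
  B phi (rtrans h psi0) = ip phi (rtrans h phi0).
Proof.
move=> Gh Vphi; have [Vphi0 Wpsi0 Bip] := dual.
have Vphi' := subrep_rtrans cV (GLAV Gh) Vphi.
rewrite -(cip_rtransr cV Gh Vphi Vphi0) -Bip// -(Binv Gh Vphi' Wpsi0).
by rewrite -rtransM mulmxfamV// rtrans1.
Qed.

(** The difference of [rtrans h psi0] and [psi0] pairs to 0 with all of [V], so it vanishes almost
    everywhere by nondegeneracy. *)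
Lemma dual_fixed (H : set (mxfam K n)) : H `<=` GLA ->
  fixed_by mu H phi0 -> fixed_by mu H psi0.
Proof.
move=> HG fixphi h Hh; have [Vphi0 Wpsi0 Bip] := dual.
have Gh := HG _ Hh; have Wh := subrep_rtrans cW Gh Wpsi0.
have B0 phi : V phi -> B phi (lincomb (-1) psi0 (rtrans h psi0)) = 0.
  move=> Vphi; rewrite Blinr// mulN1r B_rtransr// Bip// addrC.
  apply/eqP; rewrite subr_eq0; apply/eqP.
  apply: (ae_eq_cip mD); try exact: VL2.
  - exact: VL2 (subrep_rtrans cV Gh Vphi0).
  - exact: fixphi.
apply: ae_imply_on (Bnondeg (subrep_lincomb cW (-1) Wpsi0 Wh) B0) => g.
rewrite /lincomb mulN1r addrC => /eqP.
by rewrite subr_eq0 => /eqP.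
Qed.

Lemma dual_neq0 : ~ ae_zero mu phi0 -> ~ ae_zero mu psi0.
Proof.
move=> nz psi00; apply: nz; have [Vphi0 Wpsi0 Bip] := dual.
by apply/(cip_eq0 mD (VL2 Vphi0)); rewrite -Bip// B_ae0.
Qed.

End DualPair.

(** The dual of a newvector of [pi] is a nonzero vector of [tpi] fixed by the same $K_1$. This
    inclusion suffices to see that [tpi] is unramified wherever [pi] is. *)
Lemma conductor_sub : conductor pi `<=` conductor tpi.
Proof.
have [nzq qP] := conductorP pi; have [_ tqP] := conductorP tpi.
have [phi0 [Vphi0 nz fixphi]] := (qP _ nzq).2 (@subset_refl _ _).
have [psi0 dual] := exists_dual Vphi0.
apply/(tqP _ nzq); exists psi0; split; first by case: dual.
  exact: dual_neq0 dual nz.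
by apply: (dual_fixed dual) fixphi => g [].
Qed.

(** The sum of $\langle\varphi_0, R(s_i)\varphi_0\rangle$ over a double coset is computed twice. As
    a Hecke operator on [phi0], its eigenvalue leaves the second slot conjugated; through [B] it is
    a Hecke operator on [psi0], whose eigenvalue comes out unchanged. *)
Lemma satake_contragredient p r : ~ conductor pi `<=` sval p -> (r <= n)%N ->
  elsym r (satake tpi p) = (elsym r (satake pi p))^*.
Proof.
move=> pq rn; set a := satake pi p; set b := satake tpi p.
have [nzq qP] := conductorP pi.
have [phi0 [Vphi0 nz fixK1]] := (qP _ nzq).2 (@subset_refl _ _).
have fixphi : fixed_by mu (@Kp R F K n p) phi0.
  by move=> k Kk; apply: fixK1; apply: Kp_sub_K1 pq _ Kk; case: nzq.
have [psi0 dual] := exists_dual Vphi0; have [_ Wpsi0 Bip] := dual.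
have fixpsi := dual_fixed dual (@Kp_GLA R F K n p) fixphi.
have tpq : ~ conductor tpi `<=` sval p.
  by move=> H; apply: pq; exact: subset_trans conductor_sub H.
have [x xN /(_ r rn)[t [m [s [tx cs sphi]]]]] := satakeP pq.
have [x' xN' /(_ r rn)[t' [m' [s' [tx' cs' spsi]]]]] := satakeP tpq.
have N0 := ideal_norm_gt0 (K (inl p)).
have x'0 : x' != 0.
  by apply: contra_eq_neq xN' => ->; rewrite cabs0 eq_sym invr_eq0 gt_eqF.
have [u Ku tu] := hecke_elt_unit (etrans xN (esym xN')) x'0 tx tx'.
have Gt : GLA t by case: tx => -[].
have Gt' : GLA t' by case: tx' => -[].
have Gs i := coset_reps_GLA i Gt cs; have Gs' i := coset_reps_GLA i Gt' cs'.
have Ts i := subrep_rtrans cV (Gs i) Vphi0.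
have Ts' i := subrep_rtrans cW (Gs' i) Wpsi0.
pose f g := ip phi0 (rtrans g phi0).
have fK g k : GLA g -> @Kp R F K n p k -> f (mulf g k) = f g.
  move=> Gg Kk; have Gk := Kp_GLA Kk; rewrite /f rtransM.
  have Vk := subrep_rtrans cV Gk Vphi0.
  rewrite -!(cip_rtransr cV Gg)//; apply: (ae_eq_cip mD); try exact: VL2.
    by apply: VL2; apply: (subrep_rtrans cV) => //; exact: GLAV.
  exact: fixphi.
have sums := coset_reps_sum Ku tu Gt' cs cs' fK.
set c : C := (Num.sqrt _ ^+ _)%:C%C in sphi spsi.
have c0 : c != 0.
  by rewrite /c fmorph_eq0 expf_neq0// sqrtr_eq0 -ltNge.
have cR : c^* = c by apply: geC0_conj; rewrite /c lecR exprn_ge0// sqrtr_ge0.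
have sumV : \sum_i f (s i) = (c * elsym r a)^* * ip phi0 phi0.
  rewrite -(cipZr cV)// -(cip_sumr cV)//.
  apply: (ae_eq_cip mD); try exact: VL2.
  - by apply: VL2; exact: (subrep_sum cV).
  - by apply: VL2; exact: (subrepZ cV).
  - exact: sphi.
have sumW : \sum_i f (s' i) = c * elsym r b * ip phi0 phi0.
  rewrite -Bip// -B_Zr// /f; under eq_bigr do rewrite -(B_rtransr dual)//.
  rewrite -B_sumr//; apply: B_ae_eq => //.
  - exact: (subrep_sum cW).
  - exact: (subrepZ cW).
  - exact: spsi.
have ip0 : ip phi0 phi0 != 0.
  by apply/eqP => /(cip_eq0 mD (VL2 Vphi0)).
move: sums; rewrite sumV sumW => /(mulIf ip0); rewrite rmorphM/= cR.
by move=> /(mulfI c0).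
Qed.

End Contragredient.

Lemma contragredient_conductor (pi tpi : cusp_rep mu) :
  contragredient pi tpi -> conductor pi `<=` conductor tpi.
Proof.
by move=> [B [[_ Blinr] Bbound Binv Bnondeg Brep]]; exact: conductor_sub Brep.
Qed.

Lemma contragredient_satake (pi tpi : cusp_rep mu) (p : finplace F) :
  contragredient pi tpi -> ~ conductor pi `<=` sval p ->
  euler_poly (satake tpi p) = euler_poly (fun j => (satake pi p j)^*).
Proof.
move=> [B [[_ Blinr] Bbound Binv Bnondeg Brep]] pq.
rewrite !euler_poly_elsym; apply: eq_bigr => r _; congr (_ * _ *: _).
have rn : (r <= n)%N by rewrite -ltnS.
have := satake_contragredient Blinr Bbound Binv Bnondeg Brep pq rn.
rewrite /elsym => ->; rewrite rmorph_sum; apply: eq_bigr => A _.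
by rewrite rmorph_prod.
Qed.
End Representations.

(** * The inequality *)

Lemma euler_poly_pair (K : fieldType) (I J : finType) (a : I -> K) (b : J -> K) :
  \prod_i \prod_j (1 - (a i * b j)%:P * 'X) =
  euler_poly (fun x : I * J => a x.1 * b x.2).
Proof. by rewrite pair_big. Qed.

Lemma sqr_Re_le (R : realType) (z : R[i]) :
  (`|complex.Re z| ^+ 2)%:C%C <= `|z| ^+ 2.
Proof.
suff H : (`|complex.Re z| ^+ 2)%:C%C <= (Normc.normc z ^+ 2)%:C%C :> R[i].
  by apply: (le_trans H); rewrite rmorphXn.
by rewrite lecR normcE2 real_normK ?num_real// lerDl sqr_ge0.
Qed.

Lemma ideal_mul_sub_l (F : fieldExtType rat) (a b p : set F) :
  integral_ideal b -> integral_ideal p -> a `<=` p -> ideal_mul a b `<=` p.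
Proof.
move=> [bO _ _ _] [_ p0 pD pM] ap _ [m [x [y [ax byy ->]]]].
elim/big_ind: _ => // i _; rewrite mulrC; apply: pM; first exact: bO.
exact: ap.
Qed.

Lemma ideal_mul_sub_r (F : fieldExtType rat) (a b p : set F) :
  integral_ideal a -> integral_ideal p -> b `<=` p -> ideal_mul a b `<=` p.
Proof.
move=> [aO _ _ _] [_ p0 pD pM] bp _ [m [x [y [ax byy ->]]]].
elim/big_ind: _ => // i _; apply: pM; first exact: aO.
exact: bp.
Qed.

Lemma prime_ideal_mul (F : fieldExtType rat) (a b p : set F) :
  integral_ideal a -> integral_ideal b -> nonzero_prime p ->
  ideal_mul a b `<=` p -> a `<=` p \/ b `<=` p.
Proof.
move=> [aO _ _ _] [bO _ _ _] [_ _ pP] abp.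
have [|nap] := pselect (a `<=` p); first by left.
right=> y byy; apply: contrapT => npy; apply: nap => x ax.
suff /abp/(pP _ _ (aO _ ax) (bO _ byy))[] : ideal_mul a b (x * y) by [].
by exists 1%N, (fun=> x), (fun=> y); rewrite big_ord1.
Qed.

Theorem proposition3p1 (R : realType) (F : fieldExtType rat)
  (K : completions R F) (n n' : nat) (hn : (0 < n)%N) (hn' : (0 < n')%N)
  (mu : autom_measure K n) (mu' : autom_measure K n')
  (pi tpi : cusp_rep (am_measure mu)) (pi' tpi' : cusp_rep (am_measure mu'))
  (htpi : contragredient pi tpi) (htpi' : contragredient pi' tpi')
  (lam_pi lam_pi' lam_pipi' lam_pitpi lam_pi'tpi' : set F -> R[i])
  (hlam_pi : standard_coeffs pi lam_pi)
  (hlam_pi' : standard_coeffs pi' lam_pi')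
  (hlam_pipi' : rankin_selberg_coeffs pi pi' lam_pipi')
  (hlam_pitpi : rankin_selberg_coeffs pi tpi lam_pitpi)
  (hlam_pi'tpi' : rankin_selberg_coeffs pi' tpi' lam_pi'tpi')
  (nn : set F) (hnn : nonzero_ideal nn)
  (hcop : ideal_add nn (ideal_mul (conductor pi) (conductor pi'))
          = ring_of_integers F) :
  ((`|complex.Re (lam_pipi' nn - lam_pi nn * lam_pi' nn)| ^+ 2)%:C%C
     <= (lam_pitpi nn - `|lam_pi nn| ^+ 2)
        * (lam_pi'tpi' nn - `|lam_pi' nn| ^+ 2)).
Proof.
have [[iq _] _] := conductorP pi; have [[iq' _] _] := conductorP pi'.
have [[itq _] _] := conductorP tpi; have [[itq' _] _] := conductorP tpi'.
(* It remains to realise the five coefficients at [nn] as moments; the Euler expansions allow this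
   prime by prime. *)
apply: (le_trans (sqr_Re_le _)); apply: moments_cov.
rewrite hlam_pi.1// hlam_pi'.1// hlam_pipi'.1// hlam_pitpi.1// hlam_pi'tpi'.1//.
apply: moments_prod => p.
have [fin|inf] := pselect (finite_set (prime_divisors nn)); last first.
  (* [fset_set] of an infinite set is empty. *)
  by rewrite /fset_set; case: pselect => // ?; rewrite in_fset0.
rewrite in_fset_set// => /set_mem[pp nnp].
pose P : finplace F := exist _ p pp.
have [[ip _] p1 _] := pp.
(* By coprimality, a prime containing both [nn] and the product of the conductors would contain
   1. *)
have pqq : ~ ideal_mul (conductor pi) (conductor pi') `<=` p.
  move=> qqp; apply: p1; have : ring_of_integers F 1 by exact: integral1.
  rewrite -hcop => -[x [y [/nnp px /qqp py ->]]].
  by case: ip => _ _ pD _; exact: pD.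
have pq : ~ conductor pi `<=` p.
  by move=> qp; apply: pqq; exact: ideal_mul_sub_l.
have pq' : ~ conductor pi' `<=` p.
  by move=> qp; apply: pqq; exact: ideal_mul_sub_r.
(* The conductor of the contragredient contains [conductor pi], so [p] divides neither factor. *)
have ptq : ~ ideal_mul (conductor pi) (conductor tpi) `<=` p.
  move=> /(prime_ideal_mul iq itq pp)[//|tqp]; apply: pq.
  exact: subset_trans (contragredient_conductor htpi) tqp.
have ptq' : ~ ideal_mul (conductor pi') (conductor tpi') `<=` p.
  move=> /(prime_ideal_mul iq' itq' pp)[//|tqp]; apply: pq'.
  exact: subset_trans (contragredient_conductor htpi') tqp.
apply: (@rankin_selberg_moments _ _ _ (satake pi P) (satake tpi P)
  (satake pi' P) (satake tpi' P)
  (fun k => lam_pi (ideal_exp p k)) (fun k => lam_pi' (ideal_exp p k))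
  (fun k => lam_pipi' (ideal_exp p k)) (fun k => lam_pitpi (ideal_exp p k))
  (fun k => lam_pi'tpi' (ideal_exp p k))).
- exact: (contragredient_satake (p := P) htpi).
- exact: (contragredient_satake (p := P) htpi').
- exact: (hlam_pi.2 P).
- exact: (hlam_pi'.2 P).
- by rewrite -euler_poly_pair; exact: (hlam_pipi'.2 P).
- by rewrite -euler_poly_pair; exact: (hlam_pitpi.2 P).
- by rewrite -euler_poly_pair; exact: (hlam_pi'tpi'.2 P).
Qed.
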